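(* Let $(R,\mathfrak m)$ be a Cohen-Macaulay local ring of dimension $d$ with canonical module $\omega_R$, and let $I$ be an $\mathfrak m$-primary ideal of $R$ containing a parameter ideal $Q=(x_1,\ldots,x_d)$ as a reduction. Assume that the ideal $I$ is Gorenstein, i.e., the ring $R/I$ is Gorenstein. Then the following assertions are equivalent: (i) $I$ is a parameter ideal; (ii) $R$ is an Ulrich $R$-module with respect to $I$; (iii) $\omega_R$ is an Ulrich $R$-module with respect to $I$.
   Context: All rings are commutative and Noetherian with 1. A finitely generated $R$-module $M$ is maximal Cohen-Macaulay if $\mathrm{depth}_R M=\dim R$ (the zero module, of depth $+\infty$, is not). A parameter ideal is an ideal generated by a system of parameters. That $Q\subset I$ is a reduction of $I$ means $QI^r=I^{r+1}$ for some $r\ge 0$. A finitely generated $R$-module $M$ is Ulrich with respect to $I$ if $M$ is maximal Cohen-Macaulay, $IM=QM$, and $M/IM$ is a free $R/I$-module. *)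

(* Defs.v *)
From HB Require Import structures.
From mathcomp Require Import all_boot all_algebra.
From mathcomp Require Import generic_quotient ring_quotient.
From mathcomp Require Import boolp functions.

Set Implicit Arguments.
Unset Strict Implicit.
Unset Printing Implicit Defensive.

Import GRing.Theory.
Local Open Scope ring_scope.
Local Open Scope quotient_scope.

(* Ideals and submodules are boolean predicates, as in ring_quotient; classical
   logic ([boolp]) turns arbitrary propositions into such predicates.  Note that
   [idealr R] is the type of *proper* ideals of R. *)

Section Submodules.
Variables (R : comNzRingType) (V : lmodType R).

(* The submodule generated by the entries of s; the ideal (s) when V is R^o. *)
Definition spanned (s : seq V) : {pred V} :=
  fun v => `[< exists c : 'I_(size s) -> R, v = \sum_i c i *: s`_i >].

Definition fin_gen : Prop := exists s : seq V, forall v, v \in spanned s.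

(* The product I N: finite sums of products a *: w with a in I, w in N. *)
Definition smul (I : {pred R}) (N : {pred V}) : {pred V} :=
  fun v => `[< exists (n : nat) (a : 'I_n -> R) (w : 'I_n -> V),
    [/\ forall i, a i \in I, forall i, w i \in N & v = \sum_i a i *: w i] >].

Definition smulT (I : {pred R}) : {pred V} := smul I predT.

Lemma smulT_submod_closed I : GRing.submod_closed (smulT I).
Proof.
split.
  by apply/asboolP; exists 0%N, (fun=> 0), (fun=> 0); split=> [[]//|//|]; rewrite big_ord0.
move=> r _ _ /asboolP[n [a [w [aI _ ->]]]] /asboolP[p [b [z [bI _ ->]]]].
apply/asboolP; exists (n + p)%N.
exists (fun i => match fintype.split i with inl j => a j | inr j => b j end).
exists (fun i => match fintype.split i with inl j => r *: w j | inr j => z j end).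
split=> // [i|]; first by case: (fintype.split i).
rewrite big_split_ord /= scaler_sumr; congr (_ + _); apply: eq_bigr => i _.
  by rewrite -[lshift p i]/(unsplit (inl i)) unsplitK !scalerA mulrC.
by rewrite -[rshift n i]/(unsplit (inr i)) unsplitK.
Qed.

HB.instance Definition _ (I : {pred R}) :=
  GRing.isSubmodClosed.Build R V (smulT I) (smulT_submod_closed I).

End Submodules.

Arguments smulT {R} V I.
Arguments fin_gen {R} V.

Section SubAndQuotientModules.
Variables (R : comNzRingType) (V : lmodType R) (N : submodClosed V).

Definition submod : Type := {v : V | v \in N}.
HB.instance Definition _ := SubChoice.on submod.
HB.instance Definition _ := [SubChoice_isSubLmodule of submod by <:].

(* The structure [submodClosed] does not by itself provide closure under
   opposites, which [Quotient.quot] wants; this copy of N has both. *)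
Definition submod_pred : {pred V} := fun v => v \in N.
HB.instance Definition _ :=
  GRing.isSubmodClosed.Build R V submod_pred (GRing.submodClosedP N).

Definition quotmod : Type := Quotient.quot submod_pred.
HB.instance Definition _ := GRing.Zmodule.on quotmod.

Definition quotmod_pi (v : V) : quotmod := \pi_(Quotient.quot submod_pred) v.
Definition quotmod_repr (v : quotmod) : V := repr (v : Quotient.quot submod_pred).

Lemma quotmod_reprK : cancel quotmod_repr quotmod_pi.
Proof. by move=> v; exact: reprK. Qed.

Lemma quotmod_piE u v : (quotmod_pi u == quotmod_pi v) = (u - v \in N).
Proof. exact: esym (Quotient.idealrBE submod_pred u v). Qed.

Lemma quotmod_piD u v : quotmod_pi (u + v) = quotmod_pi u + quotmod_pi v.
Proof. exact: (Quotient.pi_add submod_pred u v). Qed.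

Definition quotmod_scale (a : R) (v : quotmod) : quotmod :=
  quotmod_pi (a *: quotmod_repr v).

Lemma quotmod_piZ a v : quotmod_scale a (quotmod_pi v) = quotmod_pi (a *: v).
Proof.
apply/eqP; rewrite quotmod_piE -scalerBr rpredZ // -quotmod_piE.
by rewrite quotmod_reprK.
Qed.

Lemma quotmod_scaleA a b v :
  quotmod_scale a (quotmod_scale b v) = quotmod_scale (a * b) v.
Proof. by rewrite -[v]quotmod_reprK !quotmod_piZ scalerA. Qed.

Lemma quotmod_scale1 : left_id 1 quotmod_scale.
Proof. by move=> v; rewrite -[v]quotmod_reprK quotmod_piZ scale1r. Qed.

Lemma quotmod_scaleDr : right_distributive quotmod_scale +%R.
Proof.
move=> a u v; rewrite -[u]quotmod_reprK -[v]quotmod_reprK -quotmod_piD.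
by rewrite !quotmod_piZ scalerDr quotmod_piD.
Qed.

Lemma quotmod_scaleDl v : {morph quotmod_scale^~ v : a b / a + b}.
Proof.
by move=> a b; rewrite -[v]quotmod_reprK !quotmod_piZ scalerDl quotmod_piD.
Qed.

HB.instance Definition _ := GRing.Zmodule_isLmodule.Build R quotmod
  quotmod_scaleA quotmod_scale1 quotmod_scaleDr quotmod_scaleDl.

End SubAndQuotientModules.

(* M / I M as a module over the ring R / I. *)
Section Reduction.
Variables (R : comNzRingType) (I : idealr R) (M : lmodType R).

Definition redmod : Type := quotmod (smulT M I).
HB.instance Definition _ := GRing.Zmodule.on redmod.

Definition redmod_scale (a : {ideal_quot I}) (v : redmod) : redmod :=
  repr a *: (v : quotmod (smulT M I)).

Lemma redmod_scaleE (a : R) (v : quotmod (smulT M I)) :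
  redmod_scale (\pi_{ideal_quot I} a) v = a *: v.
Proof.
rewrite /redmod_scale -[v]quotmod_reprK.
apply/eqP; rewrite [_ == _]quotmod_piE.
set w := quotmod_repr _; rewrite -scalerBl.
apply/asboolP; exists 1%N, (fun=> repr (\pi_{ideal_quot I} a) - a), (fun=> w).
split=> [_|//|]; last by rewrite big_ord1.
by rewrite Quotient.idealrBE reprK.
Qed.

Lemma redmod_scaleA a b v :
  redmod_scale a (redmod_scale b v) = redmod_scale (a * b) v.
Proof.
by rewrite -[a]reprK -[b]reprK -rmorphM !redmod_scaleE scalerA.
Qed.

Lemma redmod_scale1 : left_id 1 redmod_scale.
Proof. by move=> v; rewrite -(rmorph1 \pi_{ideal_quot I}) redmod_scaleE scale1r. Qed.

Lemma redmod_scaleDr : right_distributive redmod_scale +%R.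
Proof. by move=> a u v; rewrite /redmod_scale scalerDr. Qed.

Lemma redmod_scaleDl v : {morph redmod_scale^~ v : a b / a + b}.
Proof.
by move=> a b; rewrite -[a]reprK -[b]reprK -rmorphD !redmod_scaleE scalerDl.
Qed.

HB.instance Definition _ := GRing.Zmodule_isLmodule.Build {ideal_quot I} redmod
  redmod_scaleA redmod_scale1 redmod_scaleDr redmod_scaleDl.

End Reduction.

Definition lmod_iso (R : comNzRingType) (U V : lmodType R) : Prop :=
  exists f : {linear U -> V}, bijective f.

(* Free of finite rank, which is all that freeness can mean for the finitely
   generated modules considered here. *)
Definition free_module (R : comNzRingType) (V : lmodType R) : Prop :=
  exists n, lmod_iso V 'rV[R]_n.

Section Homological.
Variable R : comNzRingType.

Definition injective_module (E : lmodType R) : Prop :=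
  forall (A B : lmodType R) (i : {linear A -> B}) (g : {linear A -> E}),
    injective i -> exists h : {linear B -> E}, forall a, h (i a) = g a.

Definition projective_module (P : lmodType R) : Prop :=
  forall (A B : lmodType R) (p : {linear A -> B}) (g : {linear P -> B}),
    (forall b, exists a, p a = b) ->
    exists h : {linear P -> A}, forall x, p (h x) = g x.

(* 0 -> M -> E_0 -> E_1 -> ... -> E_n -> 0 exact with all E_i injective. *)
Definition finite_injdim (M : lmodType R) : Prop :=
  exists (n : nat) (E : nat -> lmodType R) (e : {linear M -> E 0%N})
         (d : forall i, {linear E i -> E i.+1}),
    [/\ forall i, injective_module (E i),
        injective e,
        forall y, d 0%N y = 0 <-> exists x, y = e x,
        forall i y, d i.+1 y = 0 <-> exists x, y = d i x
      & forall i, (n < i)%N -> forall y : E i, y = 0].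

(* ... -> P_1 -> P_0 -> N -> 0 exact with all P_i projective. *)
Record proj_resolution (N : lmodType R) := ProjResolution {
  pr_obj : nat -> lmodType R;
  pr_diff : forall i, {linear pr_obj i.+1 -> pr_obj i};
  pr_aug : {linear pr_obj 0%N -> N};
  pr_projective : forall i, projective_module (pr_obj i);
  pr_aug_surj : forall y, exists x, pr_aug x = y;
  pr_exact0 : forall y, pr_aug y = 0 <-> exists x, y = pr_diff 0%N x;
  pr_exact : forall i y, pr_diff i y = 0 <-> exists x, y = pr_diff i.+1 x
}.

Section Ext.
Variables (N : lmodType R) (P : proj_resolution N) (M : lmodType R).

(* Cocycles and coboundaries of the complex Hom_R(P, M). *)
Definition cocycle i : {pred (pr_obj P i -> M)} :=
  fun f => `[< linear f /\ forall x, f (pr_diff P i x) = 0 >].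

Definition coboundary_at i : {pred (pr_obj P i -> M)} :=
  match i with
  | 0 => fun f => `[< f = 0 >]
  | j.+1 => fun f =>
      `[< exists g : {linear pr_obj P j -> M}, f = g \o pr_diff P j >]
  end.

Lemma cocycle_submod_closed i : GRing.submod_closed (@cocycle i).
Proof.
split; first by apply/asboolP; split=> // a u v; rewrite /= scaler0 addr0.
move=> r f g /asboolP[lf f0] /asboolP[lg g0]; apply/asboolP; split.
  move=> a u v; rewrite !fctE lf lg !scalerDr !scalerA mulrC.
  by rewrite addrACA.
by move=> x; rewrite !fctE f0 g0 scaler0 addr0.
Qed.

HB.instance Definition _ i :=
  GRing.isSubmodClosed.Build R _ (@cocycle i) (cocycle_submod_closed i).

Definition coboundary i : {pred (submod (@cocycle i))} :=
  fun f => val f \in @coboundary_at i.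

Lemma coboundary_submod_closed i : GRing.submod_closed (@coboundary i).
Proof.
rewrite /coboundary; split; case: i => [|j].
- by apply/asboolP; rewrite raddf0.
- by apply/asboolP; exists \0; apply/funext.
- move=> r f g /asboolP f0 /asboolP g0; apply/asboolP.
  transitivity (r *: val f + val g); first exact: linearP.
  by rewrite f0 g0 scaler0 addr0.
move=> r f g /asboolP[f' fE] /asboolP[g' gE]; apply/asboolP.
exists (r \*: f' \+ g').
transitivity (r *: val f + val g); first exact: linearP.
by rewrite fE gE; apply/funext.
Qed.

HB.instance Definition _ i :=
  GRing.isSubmodClosed.Build R _ (@coboundary i) (coboundary_submod_closed i).

(* Ext^i_R(N, M), computed from the projective resolution P of N. *)
Definition Ext i : lmodType R := quotmod (@coboundary i).

End Ext.
End Homological.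

Section Rings.
Variable R : comNzRingType.

Definition noetherian : Prop :=
  forall J : submodClosed R^o, exists s : seq R^o, J =i spanned s.

Definition maximal_ideal (m : idealr R) : Prop :=
  forall J : idealr R, {subset m <= J} -> J =i m.

Definition local_ring (m : idealr R) : Prop :=
  maximal_ideal m /\ forall J : idealr R, maximal_ideal J -> J =i m.

Definition prime_chain (n : nat) : Prop :=
  exists P : nat -> prime_idealr R, forall i, (i < n)%N ->
    {subset P i <= P i.+1} /\ ~ {subset P i.+1 <= P i}.

Definition krull_dim (n : nat) : Prop :=
  prime_chain n /\ forall k, prime_chain k -> (k <= n)%N.

Definition ideal_gen (s : seq R) : {pred R} := spanned (s : seq R^o).

Definition ideal_mul (I J : {pred R}) : {pred R} := smul (V := R^o) I J.

Definition ideal_exp (I : {pred R}) (r : nat) : {pred R} :=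
  iter r (ideal_mul I) predT.

Definition primary_ideal (I : {pred R}) : Prop :=
  idealr_closed I /\
  forall a b, a * b \in I -> a \in I \/ exists n, b ^+ n \in I.

Definition m_primary (m : idealr R) (I : {pred R}) : Prop :=
  primary_ideal I /\ forall a, a \in m <-> exists n, a ^+ n \in I.

Definition system_of_parameters (m : idealr R) (s : seq R) : Prop :=
  krull_dim (size s) /\ m_primary m (ideal_gen s).

Definition parameter_ideal (m : idealr R) (I : {pred R}) : Prop :=
  exists s : seq R, system_of_parameters m s /\ I =i ideal_gen s.

Definition reduction (Q I : {pred R}) : Prop :=
  {subset Q <= I} /\
  exists r, ideal_mul Q (ideal_exp I r) =i ideal_exp I r.+1.

Definition gorenstein_local : Prop :=
  [/\ noetherian, exists m : idealr R, local_ring m & finite_injdim R^o].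

Definition ideal_submod (I : idealr R) : {pred R^o} := fun a => a \in I.

Lemma ideal_submod_closed I : GRing.submod_closed (ideal_submod I).
Proof.
split; first exact: (rpred0 I).
by move=> a u v uI vI; apply: (rpredD (S := I)) => //; apply: idealMr.
Qed.

HB.instance Definition _ I :=
  GRing.isSubmodClosed.Build R R^o (ideal_submod I) (ideal_submod_closed I).

Definition residue_field (m : idealr R) : lmodType R := quotmod (ideal_submod m).

End Rings.

Section Modules.
Variables (R : comNzRingType) (m : idealr R).

(* s`_i is a nonzerodivisor on M / (s`_0, ..., s`_(i-1)) M for all i, and
   M <> (s) M.  In particular there is no regular sequence on the zero module,
   which therefore has no finite depth below. *)
Definition regular_seq (M : lmodType R) (s : seq R) : Prop :=
  (forall i, (i < size s)%N -> forall v : M,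
     s`_i *: v \in smulT M (ideal_gen (take i s)) ->
     v \in smulT M (ideal_gen (take i s))) /\
  exists v : M, v \notin smulT M (ideal_gen s).

Definition regular_seq_in (M : lmodType R) (s : seq R) : Prop :=
  {subset s <= m} /\ regular_seq M s.

(* depth_R M = t: the maximal length of an M-regular sequence in m is t. *)
Definition depth (M : lmodType R) (t : nat) : Prop :=
  (exists s, regular_seq_in M s /\ size s = t) /\
  forall s, regular_seq_in M s -> (size s <= t)%N.

Definition maximal_CM (M : lmodType R) : Prop :=
  fin_gen M /\ exists n, krull_dim R n /\ depth M n.

Definition CM_local_ring : Prop :=
  [/\ noetherian R, local_ring m & exists n, krull_dim R n /\ depth R^o n].

(* The type r(M) = dim_k Ext^t_R(k, M), where k = R/m and t = depth M, is r.
   Ext does not depend on the chosen projective resolution of k. *)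
Definition module_type (M : lmodType R) (r : nat) : Prop :=
  exists (t : nat) (P : proj_resolution (residue_field m)),
    depth M t /\ lmod_iso (Ext P M t) {ffun 'I_r -> residue_field m}.

(* The definition of Bruns and Herzog, Cohen-Macaulay Rings, 3.3.1. *)
Definition canonical_module (C : lmodType R) : Prop :=
  [/\ maximal_CM C, module_type C 1 & finite_injdim C].

(* M is Ulrich with respect to I, where Q is the given parameter ideal that is
   a reduction of I. *)
Definition ulrich (I : idealr R) (Q : {pred R}) (M : lmodType R) : Prop :=
  [/\ maximal_CM M, smulT M I =i smulT M Q & free_module (redmod I M)].

End Modules.

(* Main.v *)
(** Throughout, Q = (x) and everything reduces to I = Q.

    A sequence x generating an m-primary ideal is regular on every finitely
    generated module of depth d: multiplication by elements of (x) is
    null-homotopic on the Koszul complex, so a regular sequence of length d kills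
    its cohomology below degree d, and Nakayama's lemma descends this to initial
    segments of x.  The same argument shows that an m-primary ideal needs at least
    d generators.

    (i) -> (ii): if I has d generators and Q is a reduction, exchange generators
    of I for elements of Q one at a time.  Were the exchange to stop, Q would lie
    in (u) + m I for fewer than d elements u of I, and then some power of I would
    lie in (u) by Nakayama's lemma.

    The module W = omega / Q omega has a one-dimensional socle, as
    Ext^d(k, omega) = Ext^0(k, W), and it is injective over the Artinian ring R/Q:
    killing a regular element preserves finite injective dimension, and over an
    Artinian local ring finite injective dimension forces injectivity.  Hence every
    socle element s of R/Q satisfies s w = w0 for some w in W, where w0 generates
    the socle of W.

    (ii) -> (iii): R/I = R/Q is self-injective, and such a w freely generates W.

    (iii) -> (i): W is faithful over R/Q, and I W = 0, so I lies in Q. *)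

From HB Require Import structures.
From mathcomp Require Import all_boot all_algebra.
From mathcomp Require Import generic_quotient ring_quotient.
From mathcomp Require Import boolp classical_sets functions.
Require Import Defs.

Set Implicit Arguments.
Unset Strict Implicit.
Unset Printing Implicit Defensive.

Import GRing.Theory.
Local Open Scope ring_scope.

(** * Submodules as propositions, and linear maps *)

Record subm (R : comNzRingType) (V : lmodType R) := Subm {
  in_subm :> V -> Prop;
  subm0 : in_subm 0;
  submP : forall a u v, in_subm u -> in_subm v -> in_subm (a *: u + v)
}.

Notation ideal R := (@subm R R^o).

Section SubmTheory.
Variables (R : comNzRingType) (V : lmodType R) (N : subm V).

Lemma submZ a v : N v -> N (a *: v).
Proof. by move=> Nv; rewrite -[a *: v]addr0; apply: submP => //; apply: subm0. Qed.

Lemma submD u v : N u -> N v -> N (u + v).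
Proof. by move=> Nu; rewrite -[u]scale1r; apply: submP. Qed.

Lemma submN v : N v -> N (- v).
Proof. by rewrite -scaleN1r; apply: submZ. Qed.

Lemma submB u v : N u -> N v -> N (u - v).
Proof. by move=> Nu /submN; apply: submD. Qed.

Lemma subm_sum (I : Type) (r : seq I) (P : pred I) (F : I -> V) :
  (forall i, P i -> N (F i)) -> N (\sum_(i <- r | P i) F i).
Proof. by move=> NF; elim/big_ind: _ => //; [exact: subm0|exact: submD]. Qed.

(** The boolean form, as required by the constructions [submod] and [quotmod]. *)
Definition subm_pred : {pred V} := fun v => `[< N v >].

Lemma subm_pred_closed : GRing.submod_closed subm_pred.
Proof.
split; first by apply/asboolP/subm0.
by move=> a u v /asboolP Nu /asboolP Nv; apply/asboolP/submP.
Qed.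

HB.instance Definition _ :=
  GRing.isSubmodClosed.Build R V subm_pred subm_pred_closed.

End SubmTheory.

Definition zero_subm (R : comNzRingType) (V : lmodType R) : subm V.
Proof.
by exists (fun v => v = 0) => // a u v -> ->; rewrite scaler0 addr0.
Defined.

Definition comap (R : comNzRingType) (U V : lmodType R) (f : {linear U -> V})
  (N : subm V) : subm U.
Proof.
exists (fun u => N (f u)); first by rewrite linear0; apply: subm0.
by move=> a u v; rewrite linearP; apply: submP.
Defined.

Definition range_subm (R : comNzRingType) (U V : lmodType R)
  (f : {linear U -> V}) : subm V.
Proof.
exists (fun v => exists u, v = f u); first by exists 0; rewrite linear0.
by move=> a _ _ [u ->] [v ->]; exists (a *: u + v); rewrite linearP.
Defined.

Section Maps.
Variable R : comNzRingType.

Lemma linear_map (U V : lmodType R) (f : U -> V) :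
  linear f -> exists g : {linear U -> V}, g =1 f.
Proof.
move=> lf; pose H := GRing.isLinear.Build R U V _ f lf.
by pose g : {linear U -> V} := HB.pack f H; exists g.
Qed.

(** A linear relation whose fibre over 0 is trivial is single-valued, so any choice function inside
    it is linear. This builds maps from element chases, such as connecting maps. *)
Lemma graph_linear (U V : lmodType R) (G : U -> V -> Prop) :
  (forall u, exists v, G u v) ->
  (forall a u v u' v', G u v -> G u' v' -> G (a *: u + u') (a *: v + v')) ->
  (forall v, G 0 v -> v = 0) ->
  exists f : {linear U -> V}, forall u, G u (f u).
Proof.
move=> Gtot Glin G0; have [f Gf] := choice Gtot.
have [|g gE] := @linear_map U V f; last by exists g => u; rewrite gE.
move=> a u v; apply/eqP; rewrite -subr_eq0; apply/eqP/G0.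
have := Glin (-1) _ _ _ _ (Glin a _ _ _ _ (Gf u) (Gf v)) (Gf (a *: u + v)).
by rewrite !scaleN1r addNr [- _ + f _]addrC.
Qed.

(** Quotients are used below only through this universal description, never through
    representatives. *)
Lemma quot_exists (V : lmodType R) (N : subm V) :
  exists (W : lmodType R) (p : {linear V -> W}),
    (forall w, exists v, p v = w) /\ (forall v, p v = 0 <-> N v).
Proof.
exists (quotmod (subm_pred N)).
have [|p pE] := @linear_map V (quotmod (subm_pred N)) (@quotmod_pi _ _ (subm_pred N)).
  by move=> a u v; rewrite quotmod_piD -quotmod_piZ.
exists p; split=> [w|v]; first by exists (quotmod_repr w); rewrite pE quotmod_reprK.
have -> : p v = 0 <-> p v == p 0 by rewrite linear0; split=> [->|/eqP].
by rewrite !pE (@quotmod_piE _ _ (subm_pred N)) subr0; split=> /asboolP.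
Qed.

Lemma val_linear (V : lmodType R) (S : submodClosed V) :
  linear (val : submod S -> V).
Proof. by move=> a u v; exact: linearP. Qed.

Lemma sub_exists (V : lmodType R) (N : subm V) :
  exists (W : lmodType R) (i : {linear W -> V}),
    injective i /\ (forall v, N v <-> exists w, v = i w).
Proof.
have [i iE] := linear_map (@val_linear V (subm_pred N)).
exists (submod (subm_pred N)), i; split=> [u v|v].
  by rewrite !iE => /val_inj.
split=> [Nv|[w ->]].
  have Nv' : v \in subm_pred N by apply/asboolP.
  by exists (exist _ v Nv'); rewrite iE.
by rewrite iE; apply/asboolP; exact: (valP w).
Qed.

Lemma corestrict (U W V : lmodType R) (i : {linear W -> V}) (f : {linear U -> V}) :
  injective i -> (forall u, exists w, f u = i w) ->
  exists g : {linear U -> W}, forall u, f u = i (g u).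
Proof.
move=> inji fi; apply: (@graph_linear _ _ (fun u w => f u = i w)) => //.
  by move=> a u v u' v' fu fu'; rewrite !linearP fu fu'.
by move=> v; rewrite linear0 => /esym; rewrite -[0 in RHS](linear0 i) => /inji.
Qed.

End Maps.

(** * The submodules (s)V and regular sequences *)

Section Smod.
Variable R : comNzRingType.

(** This is N + yV. Iterating it from 0 gives (s)V, so that working modulo one more element is a
    definitional step. *)
Definition add_mul (V : lmodType R) (N : subm V) (y : R) : subm V.
Proof.
exists (fun v => exists u, N (v - y *: u)).
  by exists 0; rewrite scaler0 subr0; apply: subm0.
move=> a u v [u' Hu] [v' Hv]; exists (a *: u' + v').
rewrite scalerDr scalerA mulrC -scalerA opprD addrACA -scalerBr.
exact: submP.
Defined.

Fixpoint smod (V : lmodType R) (s : seq R) : subm V :=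
  if s is y :: s' then add_mul (smod V s') y else zero_subm V.

Definition ideal_of (s : seq R) : ideal R := smod R^o s.

Lemma sub_add_mul (V : lmodType R) (N : subm V) y v : N v -> add_mul N y v.
Proof. by move=> Nv; exists 0; rewrite scaler0 subr0. Qed.

Lemma add_mulZ (V : lmodType R) (N : subm V) y v : add_mul N y (y *: v).
Proof. by exists v; rewrite subrr; apply: subm0. Qed.

Lemma smod_mul (V : lmodType R) s y (v : V) : y \in s -> smod V s (y *: v).
Proof.
elim: s => // z s IHs; rewrite inE => /orP[/eqP->|/IHs].
  exact: add_mulZ.
exact: sub_add_mul.
Qed.

Lemma smod_min (V : lmodType R) s (N : subm V) :
  (forall y v, y \in s -> N (y *: v)) -> forall v, smod V s v -> N v.
Proof.
elim: s => [_ v ->|y s IHs NZ v [u sv]]; first exact: subm0.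
rewrite -[v](subrK (y *: u)); apply: submD; last by apply: NZ; rewrite mem_head.
by apply: IHs sv => z w zs; apply: NZ; rewrite inE zs orbT.
Qed.

Lemma smod_sub (V : lmodType R) s t : {subset s <= t} ->
  forall v, smod V s v -> smod V t v.
Proof. by move=> st; apply: smod_min => y v /st; apply: smod_mul. Qed.

Lemma smod_rev (V : lmodType R) s v : smod V (rev s) v <-> smod V s v.
Proof. by split; apply: smod_sub => y; rewrite mem_rev. Qed.

Lemma scale_linear (V : lmodType R) (v : V) :
  exists f : {linear R^o -> V}, forall a, f a = a *: v.
Proof.
have [|f fE] := @linear_map R R^o V (fun a => a *: v); last by exists f.
by move=> a u w /=; rewrite scalerDl scalerA.
Qed.

Lemma smod_scale (V : lmodType R) s (a : R) (v : V) :
  ideal_of s a -> smod V s (a *: v).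
Proof.
have [f fE] := scale_linear v; rewrite -fE.
apply: (smod_min (N := comap f (smod V s))) => y b ys /=.
by rewrite fE -scalerA; apply: smod_mul.
Qed.

Lemma ideal_of_mem s y : y \in s -> ideal_of s y.
Proof. by move=> ys; rewrite -[y]mulr1; apply: (@smod_mul R^o). Qed.

Lemma ideal_ofE s (a : R) : a \in ideal_gen s <-> ideal_of s a.
Proof.
split=> [/asboolP[c ->]|].
  by apply: subm_sum => i _; apply/submZ/ideal_of_mem/mem_nth.
elim: s a => [|y s IHs] a /=.
  by move=> ->; apply/asboolP; exists (fun=> 0); rewrite big1 // => i; rewrite scale0r.
move=> [u /IHs/asboolP[c cE]]; apply/asboolP.
exists (fun i => if unlift ord0 i is Some j then c j else u).
rewrite big_ord_recl unlift_none /=; under eq_bigr do rewrite liftK.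
by rewrite -cE /GRing.scale /= mulrC addrC subrK.
Qed.

Lemma smodE (V : lmodType R) s (v : V) :
  v \in smulT V (ideal_gen s) <-> smod V s v.
Proof.
split=> [/asboolP[n [a [w [ai _ ->]]]]|].
  by apply: subm_sum => i _; apply/smod_scale/ideal_ofE.
elim: s v => [|y s IHs] v /=.
  by move=> ->; apply/asboolP; exists 0%N, (fun=> 0), (fun=> 0);
     split=> [[]//|//|]; rewrite big_ord0.
move=> [u /IHs/asboolP[n [a [w [ai _ vE]]]]]; apply/asboolP.
exists n.+1, (fun i => if unlift ord0 i is Some j then a j else y).
exists (fun i => if unlift ord0 i is Some j then w j else u); split=> //.
  move=> i; case: unliftP => [j _|_]; apply/ideal_ofE.
    by have /ideal_ofE := ai j; apply: smod_sub => z zs; rewrite inE zs orbT.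
  by apply: ideal_of_mem; rewrite mem_head.
rewrite big_ord_recl unlift_none /=; under eq_bigr do rewrite liftK.
by rewrite -vE addrC subrK.
Qed.

(* Regular sequences listed from the last element to the first. *)
Fixpoint rreg (V : lmodType R) (s : seq R) : Prop :=
  if s is y :: s' then
    rreg V s' /\ forall v, smod V s' (y *: v) -> smod V s' v
  else True.

Lemma regular_seq_rreg (V : lmodType R) s : regular_seq V s -> rreg V (rev s).
Proof.
case=> reg _; elim/last_ind: s reg => // s y IHs reg.
rewrite rev_rcons /=; split.
  apply: IHs => i lti v; have := reg i; rewrite size_rcons ltnS => /(_ (ltnW lti) v).
  by rewrite nth_rcons lti -cats1 takel_cat // ltnW.
move=> v; rewrite !smod_rev -!smodE; have := reg (size s).
by rewrite size_rcons ltnSn nth_rcons ltnn eqxx -cats1 takel_cat // take_size => H; exact: H.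
Qed.

End Smod.

(** * Local Noetherian rings *)

Section Local.
Variable R : comNzRingType.

(** Equivalently, R is local with maximal ideal ([zs]). *)
Definition local_gen (zs : seq R) : Prop :=
  ~ ideal_of zs 1 /\ forall r, ideal_of zs r \/ exists r', r' * r = 1.

Definition nilp (V : lmodType R) (N : subm V) (zs : seq R) : Prop :=
  forall z, z \in zs -> exists n, forall v, N (z ^+ n *: v).

(** Treat the generators one by one, each time multiplying by the largest power of z that stays
    outside [X]. Only stability of [X] under multiplication is used, not addition; the set of
    reachable elements in [baer_descent] is handled this way. *)
Lemma socle_ring (X : R -> Prop) (zs : seq R) :
  (forall a b, X b -> X (a * b)) ->
  (forall z, z \in zs -> exists n, forall b, X (z ^+ n * b)) ->
  ~ X 1 -> exists b, ~ X b /\ forall z, z \in zs -> X (z * b).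
Proof.
move=> XM; elim: zs => [|z zs IHs] Xn X1; first by exists 1.
have [|b [Xb Xzs]] := IHs _ X1; first by move=> y yzs; apply: Xn; rewrite inE yzs orbT.
have [n Xzn] : exists n, forall b, X (z ^+ n * b) by apply: Xn; rewrite mem_head.
have ex_k : exists k, `[< X (z ^+ k * b) >] by exists n; apply/asboolP.
case: (ex_minnP ex_k) => -[|k] /asboolP Xk kmin; first by rewrite expr0 mul1r in Xk.
exists (z ^+ k * b); split=> [/asboolP/kmin|y]; first by rewrite ltnn.
rewrite inE => /orP[/eqP->|/Xzs]; first by rewrite mulrA -exprS.
by rewrite mulrCA; apply: XM.
Qed.

Lemma socle_mod (V : lmodType R) (N : subm V) zs v : nilp N zs -> ~ N v ->
  exists b, ~ N (b *: v) /\ forall a, ideal_of zs a -> N (a *: (b *: v)).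
Proof.
move=> nilN Nv.
have [|z /nilN[n Nn]||b [Nb Nzs]] := @socle_ring (fun b => N (b *: v)) zs.
- by move=> a b; rewrite -scalerA; apply: submZ.
- by exists n => b; rewrite -scalerA.
- by rewrite scale1r.
exists b; split=> //.
have [f fE] := scale_linear (b *: v); move=> a; rewrite -fE.
apply: (smod_min (N := comap f N)) => z c zzs /=.
by rewrite fE [z *: c]mulrC -scalerA; apply: submZ; rewrite scalerA; apply: Nzs.
Qed.

(** The submodule N + I g_1 + ... + I g_n. With the unit ideal [full] it is a span modulo N; with
    the maximal ideal it is the right-hand side in Nakayama's lemma. *)
Fixpoint lin (V : lmodType R) (I : ideal R) (N : subm V) (g : seq V) : subm V.
Proof.
case: g => [|v g]; first exact: N.
exists (fun w => exists c : R, I c /\ lin V I N g (w - c *: v)).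
  by exists 0; split; [exact: subm0|rewrite scale0r subr0; exact: subm0].
move=> a u w [c [Ic Hc]] [c' [Ic' Hc']]; exists (a * c + c').
split; first exact: submP.
by rewrite scalerDl -scalerA opprD addrACA -scalerBr; apply: submP.
Defined.

Definition full : ideal R.
Proof. by exists (fun=> True). Defined.

Section Lin.
Variables (V : lmodType R) (I : ideal R).

Lemma sub_lin (N : subm V) g v : N v -> lin I N g v.
Proof.
elim: g => //= w g IHg Nv; exists 0; split; first exact: subm0.
by rewrite scale0r subr0; apply: IHg.
Qed.

Lemma lin_mul (N : subm V) g v c : v \in g -> I c -> lin I N g (c *: v).
Proof.
elim: g => //= w g IHg; rewrite inE => /orP[/eqP->|/IHg gv] Ic.
  by exists c; rewrite subrr; split=> //; apply: subm0.
by exists 0; rewrite scale0r subr0; split; [exact: subm0|exact: gv].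
Qed.

Lemma lin_min (N N' : subm V) g :
  (forall v, N v -> N' v) -> (forall c v, I c -> v \in g -> N' (c *: v)) ->
  forall v, lin I N g v -> N' v.
Proof.
move=> NN'; elim: g => //= w g IHg Ig v [c [Ic gv]].
rewrite -[v](subrK (c *: w)); apply: submD; last by apply: Ig; rewrite ?mem_head.
by apply: IHg gv => e u Ie ug; apply: Ig => //; rewrite inE ug orbT.
Qed.

End Lin.

Lemma lin_map (U V : lmodType R) (f : {linear U -> V}) I (N : subm U) (N' : subm V)
  g u : (forall u, N u -> N' (f u)) -> lin I N g u -> lin I N' (map f g) (f u).
Proof.
move=> NN'; elim: g u => //= w g IHg u [c [Ic gu]]; exists c; split=> //.
by rewrite -linearZ -linearB; apply: IHg.
Qed.

Lemma lin_scale (V : lmodType R) (I : ideal R) (N N' : subm V) g c v :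
  (forall v, N v -> N' v) -> I c -> lin full N g v -> lin I N' g (c *: v).
Proof.
move=> NN' Ic; elim: g v => [|w g IHg] v /=; first by move=> /NN'; apply: submZ.
move=> [e [_ /IHg]]; rewrite scalerBr scalerA => H; exists (c * e); split=> //.
by rewrite mulrC; apply: submZ.
Qed.

(** The coefficient 1 - c of the first generator v in its own relation is a unit, so v is eliminated
    from the other relations and the list shrinks. *)
Lemma nakayama (V : lmodType R) (N : subm V) zs (g : seq V) : local_gen zs ->
  (forall v, v \in g -> lin (ideal_of zs) N g v) -> forall v, v \in g -> N v.
Proof.
move=> [zs1 loc]; elim: g => // v g IHg gN.
have lv : lin (ideal_of zs) N g v.
  have [c [mc gv]] : lin (ideal_of zs) N (v :: g) v by apply: gN; rewrite mem_head.
  case: (loc (1 - c)) => [m1|[r r1]].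
    by case: zs1; rewrite -(subrK c 1); apply: submD.
  by rewrite -[v]scale1r -r1 -scalerA scalerBl scale1r; apply: submZ.
have gN' w : w \in g -> N w.
  apply: IHg => u ug; have [|c [mc gu]] := gN u; first by rewrite inE ug orbT.
  by rewrite -[u](subrK (c *: v)); apply: submD => //; apply: submZ.
move=> w; rewrite inE => /orP[/eqP->|/gN'//].
by apply: lin_min lv => // c u _ /gN'; apply: submZ.
Qed.

Definition noeth (V : lmodType R) : Prop := forall N : subm V, exists g : seq V,
  (forall v, v \in g -> N v) /\ (forall v, N v -> lin full (zero_subm V) g v).

Definition vanish (T : eqType) (V : lmodType R) (L : seq T) : subm (T -> V).
Proof.
exists (fun f => forall t, t \in L -> f t = 0) => // a f g f0 g0 t tL.
by rewrite !fctE f0 // g0 // scaler0 addr0.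
Defined.

Definition eval_at (T : eqType) (V : lmodType R) (t : T) (Z : subm (T -> V)) : subm V.
Proof.
exists (fun v => exists f, Z f /\ v = f t); first by exists 0; split; first exact: subm0.
by move=> a _ _ [f [Zf ->]] [g [Zg ->]]; exists (a *: f + g); split; first exact: submP.
Defined.

Definition capm (V : lmodType R) (N N' : subm V) : subm V.
Proof.
exists (fun v => N v /\ N' v); first by split; apply: subm0.
by move=> a u v [? ?] [? ?]; split; apply: submP.
Defined.

Lemma lin_cat (V : lmodType R) I (N : subm V) g h v :
  lin I (lin I N h) g v -> lin I N (g ++ h) v.
Proof.
by elim: g v => //= w g IHg v [c [Ic /IHg]]; exists c.
Qed.

(** Finite powers of a Noetherian module are Noetherian, by induction on the coordinates [L]: to
    generators modulo functions vanishing on [L], add lifts of generators for the values at t of the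
    functions in Z that vanish on [L]. Functions are compared only on [L], which also suits Koszul
    cochains. *)
Lemma noeth_fun (T : eqType) (V : lmodType R) (L : seq T) (Z : subm (T -> V)) :
  noeth V -> exists g : seq (T -> V),
  (forall f, f \in g -> Z f) /\
  (forall f, Z f -> lin full (vanish V L) g f).
Proof.
move=> nV; elim: L => [|t L [g [gZ Zg]]]; first by exists [::].
pose Z' := capm Z (vanish V L).
have [h [hZ Zh]] := nV (eval_at t Z').
have [h' h'E] : exists h' : seq (T -> V),
    (forall f, f \in h' -> Z' f) /\ [seq f t | f : T -> V <- h'] = h.
  elim: h hZ {Zh} => [|v h IHh] hZ; first by exists [::].
  have [|h' [h'Z h'E]] := IHh; first by move=> w wh; apply: hZ; rewrite inE wh orbT.
  have [f [Zf vE]] : eval_at t Z' v by apply: hZ; rewrite mem_head.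
  exists (f :: h'); split=> [f'|]; last by rewrite /= h'E vE.
  by rewrite inE => /orP[/eqP->|/h'Z].
case: h'E => h'Z h'E; exists (g ++ h'); split.
  by move=> f; rewrite mem_cat => /orP[/gZ|/h'Z[]].
move=> f Zf; apply: lin_cat.
(* Here [f1] is the actual combination of the generators, so the error left over vanishes on [L]. *)
have split_lin (h0 : seq (T -> V)) f' : lin full (vanish V L) h0 f' ->
    exists f1, lin full (zero_subm _) h0 f1 /\ vanish V L (f' - f1).
  elim: h0 f' => [|w h0 IHg] f'; first by exists 0; rewrite subr0.
  move=> [c [_ /IHg[f1 [f1g f1L]]]]; exists (c *: w + f1); rewrite opprD addrA.
  by split=> //; exists c; split; rewrite // addrC addKr.
have [f1 [f1g f1Z]] := split_lin _ _ (Zg _ Zf).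
have Zf1 : Z f1 by apply: lin_min f1g => [v ->|c v _ /gZ]; [exact: subm0|exact: submZ].
have Z'f : Z' (f - f1) by split=> //; apply: submB.
have {}Zh := Zh _ (ex_intro _ _ (conj Z'f (erefl _))).
rewrite -(subrK f1 f); apply: submD; last first.
  by apply: lin_min f1g => [v ->|c v Ic vg]; [exact: subm0|exact: lin_mul].
apply: sub_lin; move: {Z'f Zf1 f1g f1Z}(f - f1) (f1Z) Zh; rewrite -h'E.
have : forall f, f \in h' -> vanish V L f by move=> e /h'Z[].
elim: h' {h'Z h'E} => [_ e eL e0|w h' IHh h'L e eL [c [_ Hc]]].
  by move=> s; rewrite inE => /orP[/eqP->|/eL].
exists c; split=> //; apply: IHh => //; first by move=> k kh; apply: h'L; rewrite inE kh orbT.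
by apply: submB => //; apply: submZ; apply: h'L; rewrite mem_head.
Qed.

Lemma noeth_ring : noetherian R -> noeth R^o.
Proof.
move=> nR N; have [s sE] := nR (subm_pred N); exists s.
have sP a : N a <-> a \in spanned s.
  by rewrite -sE; split=> [Na|/asboolP//]; apply/asboolP.
split=> [a|a /sP/(@ideal_ofE R)].
  by move=> ain; apply/sP/(@ideal_ofE R)/ideal_of_mem.
apply: (@smod_min R R^o s (lin full (@zero_subm R R^o) s)) => y v ys.
by rewrite [y *: v]mulrC; apply: lin_mul.
Qed.

(** Pull N back to the finite free module that covers V and push generators forward. *)
Lemma noeth_fin_gen (V : lmodType R) : noeth R^o -> fin_gen V -> noeth V.
Proof.
move=> nR [s sV] N; pose n := size s.
have [|p pE] := @linear_map R ('I_n -> R^o) V (fun c => \sum_i c i *: s`_i).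
  move=> a c e; rewrite scaler_sumr -big_split; apply: eq_bigr => i _ /=.
  by rewrite scalerA -scalerDl !fctE.
have [g [gZ Zg]] := @noeth_fun _ _ (enum 'I_n) (comap p N) nR.
exists (map p g); split=> [_ /mapP[c cg ->]|v Nv]; first exact: gZ.
have /asboolP[c vE] := sV v.
have -> : v = p c by rewrite pE.
apply: (lin_map (N := @vanish _ R^o (enum 'I_n))).
  by move=> e e0 /=; rewrite pE big1 // => i _; rewrite e0 ?mem_enum // scale0r.
by apply: Zg => /=; rewrite pE -vE.
Qed.

End Local.

(** * Generators of the maximal ideal *)

Section LocalRing.
Variables (R : comNzRingType) (m : idealr R).

Lemma idealr_of_set (J : {pred R}) : idealr_closed J -> exists K : idealr R, K =i J.
Proof.
move=> Jid; pose H := @isIdealr.Build R J Jid.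
by pose K : idealr R := HB.pack J H; exists K.
Qed.

Lemma nonunit_maximal (r : R) : (forall r', r' * r <> 1) ->
  exists J : idealr R, maximal_ideal J /\ r \in J.
Proof.
move=> nu; pose idl (X : set R) :=
  [/\ ~ X 1, X r & forall a u v, X u -> X v -> X (a * u + v)].
pose P (X : set R) := X = set0 \/ idl X.
have [F FP totF|A [PA Amax]] := @Zorn_bigcup R P.
  have [Fr|Fr] := pselect (exists2 X, F X & X r); last first.
    left; apply/seteqP; split=> // a [X FX Xa].
    by have [X0|[_ Xr _]] := FP _ FX; [rewrite X0 in Xa|case: Fr; exists X].
  right; have Fid X a : F X -> X a -> idl X.
    by move=> FX Xa; have [X0|//] := FP _ FX; rewrite X0 in Xa.
  split=> [[X FX X1]||a u v [X FX Xu] [Y FY Yv]].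
  - by have [] := Fid _ _ FX X1.
  - by have [X FX Xr] := Fr; exists X.
  have [XY|YX] := totF X Y FX FY.
    by have [_ _ YP] := Fid _ _ FY Yv; exists Y => //; apply: YP => //; apply: XY.
  by have [_ _ XP] := Fid _ _ FX Xu; exists X => //; apply: XP => //; apply: YX.
have [A1 Ar AP] : idl A.
  case: PA => // A0; case: (Amax [set a | exists c, a = c * r]%classic).
    rewrite A0; split; first exact: sub0set.
    by move=> /(_ r); apply; exists 1; rewrite mul1r.
  right; split=> [[c /esym/nu]//||a _ _ [u ->] [v ->]].
    by exists 1; rewrite mul1r.
  by exists (a * u + v); rewrite mulrDl mulrA.
pose JA : {pred R} := fun a => `[< A a >].
have [|J JE] := @idealr_of_set JA.
  split; [|by apply/negP => /asboolP|].
    by apply/asboolP; have := AP (-1) _ _ Ar Ar; rewrite mulN1r addNr.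
  by move=> a u v /asboolP Au /asboolP Av; apply/asboolP/AP.
exists J; split; last by rewrite JE; apply/asboolP.
move=> J' JJ' a; apply/idP/idP; last exact: JJ'.
move=> aJ'; apply/negPn/negP => aJ; apply: (Amax [set b | b \in J']%classic).
  split=> [b Ab|/(_ a aJ') Aa]; first by apply: JJ'; rewrite JE; apply/asboolP.
  by move: aJ; rewrite JE => /asboolP.
right; split=> [||b u v uJ' vJ'] /=; first by rewrite idealr1.
  by apply: JJ'; rewrite JE; apply/asboolP.
by apply: rpredD => //; apply: idealMr.
Qed.

Lemma local_gen_exists : noetherian R -> local_ring m ->
  exists zs : seq R, local_gen zs /\ forall a, a \in m <-> ideal_of zs a.
Proof.
move=> nR [mmax munique].
have [zs mE] : exists zs : seq R, forall a : R, a \in m <-> ideal_of zs a.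
  have [s sE] := nR (ideal_submod m); exists s => a.
  have -> : (a \in m) = (a \in ideal_gen (s : seq R)) by rewrite -sE.
  exact: (@ideal_ofE R).
exists zs; split=> //; split=> [/mE|r]; first by rewrite idealr1.
have [[r' r'r]|nu] := pselect (exists r', r' * r = 1); first by right; exists r'.
left; apply/mE; have [|J [Jmax Jr]] := @nonunit_maximal r.
  by move=> r' r'r; apply: nu; exists r'.
by rewrite -(munique J).
Qed.

End LocalRing.

(** * Koszul cohomology and regular sequences *)

Section Koszul.
Variables (R : comNzRingType) (M : lmodType R).
Local Notation F := (seq bool -> M).

(* A Koszul cochain of s with values in M is a family indexed by bit strings
   of length size s, of degree the number of true bits; only the values at
   strings of the relevant length and degree ever matter. *)
Fixpoint kz (s : seq R) (a : F) : F :=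
  if s is x :: s' then
    fun t => match t with
    | [::] => 0
    | true :: t' => x *: a (false :: t') - kz s' (fun t => a (true :: t)) t'
    | false :: t' => kz s' (fun t => a (false :: t)) t'
    end
  else fun=> 0.

Definition pt (n i : nat) (t : seq bool) : bool := (size t == n) && (count id t == i).

Lemma kz_linear s : linear (kz s).
Proof.
elim: s => [|x s IHs] c a b; apply/funext => t /=; first by rewrite fctE scaler0 addr0.
case: t => [|[] t]; rewrite !fctE /=; first by rewrite scaler0 addr0.
  rewrite (IHs c (fun t => a (true :: t)) (fun t => b (true :: t))) !fctE.
  rewrite scalerDr scalerBr !scalerA [x * c]mulrC opprD addrACA.
  by [].
by rewrite (IHs c (fun t => a (false :: t)) (fun t => b (false :: t))).
Qed.

HB.instance Definition _ s := GRing.isLinear.Build R F F _ (kz s) (kz_linear s).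

Lemma kz_deg0 s a t : pt (size s) 0 t -> kz s a t = 0.
Proof.
elim: s t a => // y s IHs [|[] t] //= a /andP[st]; first by [].
by move=> ct; apply: (IHs t (fun u => a (false :: u))); rewrite /pt -eqSS st.
Qed.

Lemma kz_local (N : subm M) s i a :
  (forall t, pt (size s) i t -> N (a t)) ->
  forall t, pt (size s) i.+1 t -> N (kz s a t).
Proof.
elim: s i a => [|x s IHs] i a Na t; first by move=> _; apply: subm0.
case: t => [|[] t] //; rewrite /pt /= eqSS => pt_t.
  rewrite add1n eqSS in pt_t.
  apply: submB; first by apply/submZ/Na; rewrite /pt /= eqSS.
  case: i pt_t Na => [|i] pt_t Na.
    rewrite kz_deg0; [exact: subm0|exact: pt_t].
  by apply: IHs pt_t => u pu; apply: Na; rewrite /pt /= eqSS add1n eqSS.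
by apply: IHs pt_t => u pu; apply: Na; rewrite /pt /= eqSS.
Qed.

Lemma kz_kz s a : kz s (kz s a) = 0.
Proof.
elim: s a => [|x s IHs] a; apply/funext => -[|[] t] //=; last first.
  by rewrite (IHs (fun t => a (false :: t))).
set a0 := fun t => a (false :: t); set a1 := fun t => a (true :: t).
change (x *: kz s a0 t - kz s (x *: a0 - kz s a1) t = 0).
by rewrite linearB linearZ /= IHs subr0 subrr.
Qed.

(** For the head of [s], the homotopy turns a leading bit false into true and reads the cochain
    there; for a later element, it is the homotopy of the tail on both halves, with a sign on the
    true half. It respects every submodule N, hence works with coefficients in M/N. *)
Lemma kz_homotopy s x : x \in s -> exists h : {linear F -> F},
  (forall (N : subm M) i a, (forall t, pt (size s) i.+1 t -> N (a t)) ->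
     forall t, pt (size s) i t -> N (h a t)) /\
  (forall a t, size t = size s -> kz s (h a) t + h (kz s a) t = x *: a t).
Proof.
elim: s => // y s IHs; rewrite inE; have [->|_ /= /IHs[h [hN hkz]]] := eqVneq x y.
  move=> _; pose h (a : F) t := if t is false :: t' then a (true :: t') else 0.
  have [|h' h'E] := @linear_map R F F h.
    move=> c a b; apply/funext => -[|[] t]; rewrite !fctE /= ?scaler0 ?addr0 //.
  exists h'; split=> [N i a Na t|a t]; rewrite ?h'E.
    case: t => [|[] t] //= /andP[st ct]; try exact: subm0.
    by apply: Na; rewrite /pt /= st add1n eqSS.
  case: t => [|[] t] //= _.
    rewrite addr0 (_ : (fun t => _) = 0) // linear0 /h /= -[0 t]/0.
    by rewrite subr0.
  rewrite /h /= addrCA.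
  by rewrite -[fun t => _]/(fun t => a (true :: t)) subrr addr0.
pose g (a : F) t := if t is b :: t' then
    if b then - h (fun t => a (true :: t)) t' else h (fun t => a (false :: t)) t'
  else 0.
have [|g' g'E] := @linear_map R F F g.
  move=> c a b; apply/funext => -[|[] t]; rewrite !fctE /= ?scaler0 ?addr0 //.
    rewrite (linearP h c (fun t => a (true :: t)) (fun t => b (true :: t))).
    by rewrite opprD -scalerN.
  by rewrite (linearP h c (fun t => a (false :: t)) (fun t => b (false :: t))).
exists g'; split=> [N i a Na t|a t]; rewrite ?g'E.
  case: t => [|[] t] //=; rewrite /pt /= eqSS ?add1n => pt_t; first last.
    by apply: hN pt_t => u pu; apply: Na; rewrite /pt /= eqSS.
  case: i pt_t Na => [|i] pt_t Na; first by rewrite andbF in pt_t.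
  by apply/submN/(hN N i) => // u pu; apply: Na; rewrite /pt /= eqSS add1n eqSS.
case: t => [|[] t] //= [st]; last exact: hkz.
set a0 := fun t => a (false :: t); set a1 := fun t => a (true :: t).
change (y *: h a0 t - kz s (- h a1) t - h (y *: a0 - kz s a1) t = x *: a1 t).
rewrite -hkz // linearN linearB linearZ.
change (y *: h a0 t - - kz s (h a1) t - (y *: h a0 t - h (kz s a1) t) =
        kz s (h a1) t + h (kz s a1) t).
by rewrite opprK opprB addrC addrA subrK addrC.
Qed.

(** Vanishing of the i-th Koszul cohomology of s with coefficients in M/N; cochains are represented
    by lifts to M. *)
Definition kexact (s : seq R) (i : nat) (N : subm M) : Prop := forall a : F,
  (forall t, pt (size s) i.+1 t -> N (kz s a t)) ->
  exists b, forall t, pt (size s) i t -> N (a t - kz s b t).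

Definition kbound (s : seq R) (i : nat) (N : subm M) : subm F.
Proof.
exists (fun a => exists b, forall t, pt (size s) i t -> N (a t - kz s b t)).
  by exists 0 => t _; rewrite linear0 subr0; apply: subm0.
move=> c u v [b Hb] [b' Hb']; exists (c *: b + b') => t pt_t.
rewrite linearP; change (N (c *: u t + v t - (c *: kz s b t + kz s b' t))).
by rewrite opprD addrACA -scalerBr; apply: submP; [exact: Hb|exact: Hb'].
Defined.

Definition kcyc (s : seq R) (i : nat) (N : subm M) : subm F.
Proof.
exists (fun a => forall t, pt (size s) i.+1 t -> N (kz s a t)).
  by move=> t _; rewrite linear0; apply: subm0.
move=> c u v Hu Hv t pt_t; rewrite linearP.
change (N (c *: kz s u t + kz s v t)).
by apply: submP; [exact: Hu|exact: Hv].
Defined.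

Lemma kz_ideal (N : subm M) s i y (a : F) : ideal_of s y ->
  kcyc s i N a -> kbound s i N (y *: a).
Proof.
move=> sy cyc; have [f fE] := scale_linear a.
rewrite -fE; apply: (smod_min (N := comap f (kbound s i N))) sy => x v xs.
change (kbound s i N (f (x * v))); rewrite fE mulrC -scalerA; apply: submZ.
have [h [hN hkz]] := kz_homotopy xs; exists (h a) => t pt_t.
change (N (x *: a t - kz s (h a) t)); rewrite -hkz; last by case/andP: pt_t => /eqP.
by rewrite addrC addKr; apply: hN pt_t.
Qed.

(* A cocycle some multiple [y ^+ k] of which bounds is itself a boundary: divide
   by the regular element y, using exactness modulo y one degree below. *)
Lemma kexact_lift (N : subm M) s i y k : (forall v, N (y *: v) -> N v) ->
  ideal_of s (y ^+ k) ->
  (forall i', i = i'.+1 -> kexact s i' (add_mul N y)) -> kexact s i N.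
Proof.
move=> Nreg sy ex.
have div a : kcyc s i N a -> kbound s i N (y *: a) -> kbound s i N a.
  move=> cyc [b Hb]; case: i ex cyc Hb => [|i] ex cyc Hb.
    exists 0 => t pt_t; rewrite linear0 subr0; apply: Nreg.
    by have := Hb t pt_t; rewrite kz_deg0 // subr0.
  (* As ya = db modulo N, the cochain b is a cocycle modulo N + yM. Hence b = dc + ye modulo N, so
     ya = y de, and y cancels. *)
  have [|c Hc] := ex i (erefl _) b.
    move=> t pt_t; exists (a t); rewrite -[_ - _]opprB; apply: submN.
    exact: Hb.
  have [e He] : exists e : F, forall t, pt (size s) i t ->
      N (b t - kz s c t - y *: e t).
    suff /choice[e He] : forall t, exists v, pt (size s) i t ->
      N (b t - kz s c t - y *: v) by exists e.
    by move=> t; case: (boolP (pt _ _ _)) => [/Hc[v Hv]|_]; [exists v|exists 0].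
  exists e => t pt_t; apply: Nreg.
  have := kz_local (a := b - kz s c - y *: e) He pt_t.
  rewrite !linearB linearZ /= kz_kz subr0.
  change (N (kz s b t - y *: kz s e t) -> N (y *: a t - y *: kz s e t)) => Ht.
  have -> : y *: a t - y *: kz s e t =
    (y *: a t - kz s b t) + (kz s b t - y *: kz s e t) by rewrite addrA subrK.
  by apply: submD; first exact: Hb.
move=> a cyc; have {sy} : kbound s i N (y ^+ k *: a) by apply: kz_ideal.
elim: k => [|k IHk]; first by rewrite expr0 scale1r.
by rewrite exprS -scalerA => /div Hk; apply/IHk/Hk/submZ.
Qed.

(** Depth sensitivity of the Koszul complex. Lists are reversed, so [q] comes first in the regular
    sequence and [p] is what remains on M/qM; each element of [p] moved to [q] costs one degree. *)
Lemma kexact_rreg s p q : rreg M (p ++ q) ->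
  (forall y, y \in p -> exists k, ideal_of s (y ^+ k)) ->
  forall i, (i < size p)%N -> kexact s i (smod M q).
Proof.
elim/last_ind: p q => // p y IHp q; rewrite cat_rcons => reg rad i.
rewrite size_rcons ltnS => lei.
have [k yk] : exists k, ideal_of s (y ^+ k) by apply: rad; rewrite mem_rcons mem_head.
have reg_y : forall v, smod M q (y *: v) -> smod M q v.
  by elim: p reg {IHp rad lei} => [[]|z p IHp [/IHp]].
apply: (kexact_lift reg_y yk) => j ij; apply: (IHp (y :: q)) => //.
  by move=> z zp; apply: rad; rewrite mem_rcons inE zp orbT.
by rewrite ij in lei.
Qed.

(** The long exact sequence for [x :: s] makes x surjective on the i-th cohomology of s, which is
    finitely generated, so Nakayama's lemma kills it. *)
Lemma kexact_tail zs x s i N : noeth M -> local_gen zs -> ideal_of zs x ->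
  kexact (x :: s) i.+1 N -> kexact s i N.
Proof.
move=> nM loc mx ex.
have step a : kcyc s i N a ->
    exists a' e, [/\ kcyc s i N a', kbound s i N e & a = x *: a' + e].
  (* Placed on the strings with leading bit true, [a] becomes a cocycle for [x :: s]. The halves of
     a bounding cochain give a = x B0 - d B1 modulo N with B0 a cocycle. *)
  move=> cyc; pose A t := if t is true :: t' then a t' else 0.
  have [|B HB] := ex A.
    move=> [|[] t] //; rewrite /pt /= eqSS => pt_t; last first.
      have -> : (fun t => A (false :: t)) = 0 by [].
      by rewrite linear0; apply: subm0.
    rewrite scaler0 sub0r; apply/submN/cyc.
    by rewrite add1n in pt_t.
  pose B0 t := B (false :: t); pose B1 t := B (true :: t).
  exists B0, (a - x *: B0); split; last by rewrite addrC subrK.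
    move=> t pt_t; have := HB (false :: t); rewrite /pt /= eqSS sub0r.
    by move=> /(_ pt_t)/submN; rewrite opprK.
  exists (- B1) => t pt_t; have := HB (true :: t); rewrite /pt /= eqSS add1n eqSS.
  move=> /(_ pt_t); rewrite linearN opprB opprK addrA.
  by rewrite addrAC.
pose L := [seq val t | t : (size s).-tuple bool <- enum {: (size s).-tuple bool}].
have [g [gcyc cycg]] := @noeth_fun _ _ M L (kcyc s i N) nM.
have van f : vanish M L f -> kbound s i N f.
  move=> f0; exists 0 => t /andP[st _]; rewrite linear0 subr0 f0; first exact: subm0.
  by apply/mapP; exists (Tuple st); rewrite ?mem_enum.
have gb : forall f, f \in g -> kbound s i N f.
  apply: (nakayama loc) => f /gcyc /step[a' [e [/cycg a'g eb ->]]].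
  apply: submD; last exact: sub_lin.
  exact: lin_scale a'g.
move=> a /cycg ag; change (kbound s i N a).
by apply: lin_min ag => [f /van//|c f _ /gb]; apply: submZ.
Qed.

(** The cohomology in top degree is M/sM. *)
Lemma kz_top s v : smod M s v <-> exists c, v = kz s c (nseq (size s) true).
Proof.
elim: s v => [|x s IHs] v /=; first by split=> [->|[_ ->]] //; exists 0.
split=> [[u /IHs[c vE]]|[c ->]].
  exists (fun t => if t is true :: t' then - c t' else u).
  change (v = x *: u - kz s (- c) (nseq (size s) true)).
  by rewrite linearN -[RHS]/(_ - - kz s c _) opprK -vE addrC subrK.
exists (c (false :: nseq (size s) true)); rewrite addrAC subrr sub0r.
apply/submN/IHs; by exists (fun t => c (true :: t)).
Qed.

(** A relation x v = (top value of dc) says that v and c are the two halves of a cocycle of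
    [x :: s], one degree below the top. Bounding it exhibits v as a top coboundary for s. *)
Lemma kexact_reg x s v : kexact (x :: s) (size s) (zero_subm M) ->
  smod M s (x *: v) -> smod M s v.
Proof.
move=> ex /kz_top[c xv].
have pt_top t : pt (size s) (size s) t -> t = nseq (size s) true.
  case/andP => /eqP st /eqP ct; rewrite -st; apply/all_pred1P.
  by move: ct; rewrite -st => /eqP; rewrite -all_count; apply: sub_all => -[].
pose A t := match t with true :: t' => c t' | _ => v end.
have [|B HB] := ex A.
  move=> [|[] t] //; rewrite /pt /= eqSS.
    rewrite add1n eqSS => /pt_top->; rewrite xv; apply/eqP; rewrite subr_eq0; exact/eqP.
  case/andP => /eqP st; rewrite add0n => /eqP ct.
  by have := count_size id t; rewrite ct st ltnn.
apply/kz_top; exists (fun t => B (false :: t)); apply/eqP; rewrite -subr_eq0; apply/eqP.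
apply: (HB (false :: nseq (size s) true)).
by rewrite /pt /= size_nseq count_nseq mul1n !eqxx.
Qed.

Lemma kexact_smod s v : kexact s (size s) (zero_subm M) -> smod M s v.
Proof.
move=> ex; have [|b Hb] := ex (fun=> v).
  move=> t /andP[/eqP st /eqP ct]; have := count_size id t.
  by rewrite ct st ltnn.
apply/kz_top; exists b; apply/eqP; rewrite -subr_eq0; apply/eqP/Hb.
by rewrite /pt size_nseq count_nseq mul1n !eqxx.
Qed.

Lemma kexact_rreg_conv (zs s : seq R) : noeth M -> local_gen zs ->
  (forall x, x \in s -> ideal_of zs x) ->
  (forall i, (i < size s)%N -> kexact s i (zero_subm M)) -> rreg M s.
Proof.
move=> nM loc; elim: s => //= x s IHs ms ex; split.
  apply: IHs => [y ys|i lti]; first by apply: ms; rewrite inE ys orbT.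
  apply: (kexact_tail nM loc (ms x _)); first by rewrite mem_head.
  exact: ex.
by move=> v; apply: kexact_reg; apply: ex.
Qed.

(** The regular sequence [ys] kills the Koszul cohomology of [s] below degree [size s], and over a
    local ring this vanishing forces regularity. *)
Lemma sop_rreg (zs s ys : seq R) : noeth M -> local_gen zs ->
  (forall x, x \in s -> ideal_of zs x) ->
  (forall y, y \in ys -> exists k, ideal_of s (y ^+ k)) ->
  rreg M ys -> (size s <= size ys)%N -> rreg M s.
Proof.
move=> nM loc ms rad reg les; apply: (kexact_rreg_conv nM loc ms) => i lti.
apply: (kexact_rreg (p := ys) (q := [::])) => //; first by rewrite cats0.
exact: leq_trans les.
Qed.

(** With fewer elements in [s] than in [ys], vanishing reaches the top degree, where the cohomology
    is M/sM. *)
Lemma few_generators (s ys : seq R) v : rreg M ys ->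
  (forall y, y \in ys -> exists k, ideal_of s (y ^+ k)) ->
  (size s < size ys)%N -> smod M s v.
Proof.
move=> reg rad lts; apply/kexact_smod/(kexact_rreg (p := ys) (q := [::])) => //.
by rewrite cats0.
Qed.

End Koszul.

(** * Ext and regular sequences *)

Section ExtCochains.
Variable R : comNzRingType.

(** Surjectivity is needed only onto the image of [g]: corestrict both maps to the range of [p]. *)
Lemma proj_lift (P A B : lmodType R) (p : {linear A -> B}) (g : {linear P -> B}) :
  projective_module P -> (forall x, exists a, p a = g x) ->
  exists h : {linear P -> A}, forall x, p (h x) = g x.
Proof.
move=> projP pg; have [W [i [inji iW]]] := sub_exists (range_subm p).
have [p' p'E] : exists p' : {linear A -> W}, forall a, p a = i (p' a).
  by apply: corestrict => // a; apply/iW; exists a.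
have [g' g'E] : exists g' : {linear P -> W}, forall x, g x = i (g' x).
  by apply: corestrict => // x; apply/iW; have [a] := pg x; exists a.
have [w|h hE] := projP _ _ p' g'; last by exists h => x; rewrite p'E hE -g'E.
have /iW[a wa] : exists w', i w = i w' by exists w.
by exists a; apply: inji; rewrite -p'E.
Qed.

Variables (K M : lmodType R) (P : proj_resolution K).
Local Notation d := (pr_diff P).

Lemma dd0 i x : d i (d i.+1 x) = 0.
Proof. by apply/pr_exact; exists x. Qed.

(** Multiplication by y lifts the zero map of K, so it is null-homotopic on P. Only dhd = yd is
    kept, which follows from dh + hd = y by composing with d. *)
Lemma homotopy y : (forall v : K, y *: v = 0) -> forall i,
  exists h : {linear pr_obj P i -> pr_obj P i.+1},
    forall x, d i (h (d i x)) = y *: d i x.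
Proof.
move=> yK; elim=> [|i [h hE]].
  have [|g gE] := @linear_map R _ (pr_obj P 0) (fun x => y *: x).
    by move=> c u v; rewrite scalerDr !scalerA mulrC.
  have [|h hE] := proj_lift (p := d 0%N) (g := g) (@pr_projective _ _ P 0).
    move=> x; rewrite gE.
    have /pr_exact0[z zE] : pr_aug P (y *: x) = 0 by rewrite linearZ /= yK.
    by exists z.
  by exists h => x; rewrite hE gE.
have [|g gE] := @linear_map R _ (pr_obj P i.+1) (fun x => y *: x - h (d i x)).
  move=> c u v; rewrite (linearP (d i)) (linearP h) scalerDr scalerBr opprD addrACA !scalerA.
  by rewrite mulrC.
have [|h' h'E] := proj_lift (p := d i.+1) (g := g) (@pr_projective _ _ P i.+1).
  move=> x; have /pr_exact[z zE] : d i (g x) = 0.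
    by rewrite gE linearB linearZ /= hE subrr.
  by exists z.
by exists h' => x; rewrite h'E gE dd0 linear0 subr0.
Qed.

Definition bound i : (pr_obj P i -> M) -> Prop :=
  match i with
  | 0 => fun u => forall x, u x = 0
  | j.+1 => fun u => exists g : {linear pr_obj P j -> M}, forall x, u x = g (d j x)
  end.

Lemma bound_d i (u : pr_obj P i -> M) x : bound u -> u (d i x) = 0.
Proof. by case: i u x => [|i] u x /=; [exact|move=> [g ->]; rewrite dd0 linear0]. Qed.

(* Cochains with values in M / N are represented by maps to M, which exist since
   the modules of P are projective. *)
Definition ext_zero i (N : subm M) : Prop :=
  forall f : {linear pr_obj P i -> M}, (forall x, N (f (d i x))) ->
  exists u : {linear pr_obj P i -> M}, bound u /\ forall x, N (f x - u x).

(** The i-th Ext of K with values in M/N is nonzero and generated by the class of [f0]. *)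
Definition ext_cyclic i (N : subm M) : Prop :=
  exists f0 : {linear pr_obj P i -> M},
  [/\ forall x, N (f0 (d i x)),
      forall u : {linear pr_obj P i -> M}, bound u -> ~ forall x, N (f0 x - u x)
    & forall f : {linear pr_obj P i -> M}, (forall x, N (f (d i x))) ->
      exists r (u : {linear pr_obj P i -> M}),
        bound u /\ forall x, N (f x - r *: f0 x - u x)].

Lemma lift_mul i (N : subm M) y (f : {linear pr_obj P i -> M}) :
  (forall x, add_mul N y (f x)) ->
  exists v : {linear pr_obj P i -> M}, forall x, N (f x - y *: v x).
Proof.
move=> fN; have [W [p [_ p0]]] := quot_exists N.
have [|py pyE] := @linear_map R M W (fun u => p (y *: u)).
  by move=> c u v; rewrite scalerDr scalerA mulrC -scalerA linearP.
have [|v vE] := proj_lift (p := py) (g := p \o f) (@pr_projective _ _ P i).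
  move=> x; have [u /p0 Nu] := fN x; exists u; rewrite pyE /=.
  by apply/esym/eqP; rewrite -subr_eq0 -linearB Nu.
exists v => x; apply/p0; have /= := vE x; rewrite pyE linearB => ->.
by rewrite subrr.
Qed.

Section Step.
Variables (N : subm M) (y : R).
Hypotheses (yK : forall v : K, y *: v = 0) (Nreg : forall v, N (y *: v) -> N v).

Lemma cocycle_homotopy i (h : {linear pr_obj P i -> pr_obj P i.+1})
  (f : {linear pr_obj P i.+1 -> M}) :
  (forall x, d i (h (d i x)) = y *: d i x) -> (forall x, N (f (d i.+1 x))) ->
  forall x, N (y *: f x - f (h (d i x))).
Proof.
move=> hE fcoc x; rewrite -linearZ -linearB.
have /pr_exact[z ->//] : d i (y *: x - h (d i x)) = 0.
by rewrite linearB linearZ /= hE subrr.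
Qed.

(** The assignment of f \o h to f is a section of the connecting map from Ext^i into M/(N + yM) to
    Ext^(i+1) into M/N, because f h d = y f modulo N. This is its injectivity on classes. *)
Lemma bound_lift i (h : {linear pr_obj P i -> pr_obj P i.+1})
  (f : {linear pr_obj P i.+1 -> M}) (u : {linear pr_obj P i -> M}) :
  (forall x, d i (h (d i x)) = y *: d i x) -> (forall x, N (f (d i.+1 x))) ->
  bound u -> (forall x, add_mul N y (f (h x) - u x)) ->
  exists u' : {linear pr_obj P i.+1 -> M}, bound u' /\ forall x, N (f x - u' x).
Proof.
move=> hE fcoc bu fhu.
have [v vE] := lift_mul (f := (f \o h) \- u) fhu.
exists (v \o d i); split; first by exists v.
move=> x; apply: Nreg => /=.
have := submD (cocycle_homotopy hE fcoc x) (vE (d i x)) => /=.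
by rewrite bound_d // subr0 addrA subrK scalerBr.
Qed.

Lemma ext_zero0 : ext_zero 0 N.
Proof.
move=> f fcoc; exists \0; split=> // x; rewrite subr0; apply: Nreg.
rewrite -linearZ; have /pr_exact0[z ->//] : pr_aug P (y *: x) = 0.
by rewrite linearZ /= yK.
Qed.

Lemma homotopy_cocycle i (h : {linear pr_obj P i -> pr_obj P i.+1})
  (f : {linear pr_obj P i.+1 -> M}) :
  (forall x, d i (h (d i x)) = y *: d i x) -> (forall x, N (f (d i.+1 x))) ->
  forall x, add_mul N y (f (h (d i x))).
Proof.
move=> hE fcoc x; exists (f x); rewrite -opprB; apply: submN.
exact: cocycle_homotopy.
Qed.

Lemma ext_zeroS i : ext_zero i (add_mul N y) -> ext_zero i.+1 N.
Proof.
move=> V f fcoc; have [h hE] := homotopy yK i.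
have [u [bu fu]] := V (f \o h) (homotopy_cocycle hE fcoc).
exact: bound_lift fu.
Qed.

(** When Ext^i into M/N vanishes, the connecting map is an isomorphism, so cyclicity passes down one
    degree. *)
Lemma ext_cyclic_step i :
  ext_zero i N -> ext_cyclic i.+1 N -> ext_cyclic i (add_mul N y).
Proof.
move=> V [g0 [g0coc g0nb g0gen]]; have [h hE] := homotopy yK i.
exists (g0 \o h); split.
- exact: homotopy_cocycle.
- move=> u bu fu; have [u' [bu' Nu']] := bound_lift hE g0coc bu fu.
  exact: g0nb bu' Nu'.
move=> f fcoc; have [g gE] := lift_mul (f := f \o d i) fcoc.
have [|r [w [[v wE] Hv]]] := g0gen g.
  move=> x; apply: Nreg; have := gE (d i.+1 x) => /=.
  by rewrite dd0 linear0 sub0r => /submN; rewrite opprK.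
(* The connecting map sends f and r (g0 h) to the same class. Correcting by y v, which is zero
   modulo N + yM, turns the difference into a cocycle modulo N. *)
pose e : {linear pr_obj P i -> M} := f \- (r \*: (g0 \o h)) \- (y \*: v).
have [x|u [bu Hu]] := V e; last first.
  exists r, u; split=> // x; exists (v x).
  by have := Hu x; rewrite /e /= addrAC.
have H1 := gE x; have H2 := submZ r (cocycle_homotopy hE g0coc x).
have H3 := submZ y (Hv x); have := submD (submD H1 H2) H3.
rewrite /e /= wE !scalerBr !scalerA [y * r]mulrC.
set a := f _; set b := _ *: g x; set c := (r * y) *: _; set k := r *: _; set q := y *: _.
have -> : a - b + (c - k) = (a - k) - (b - c).
  by rewrite opprB addrACA [- b - k]addrC addrACA.
by rewrite addrA subrK.
Qed.

End Step.

Lemma rreg_cat s y t : rreg M (s ++ y :: t) ->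
  forall v, smod M t (y *: v) -> smod M t v.
Proof. by elim: s => [[]|z s IHs [/IHs]]. Qed.

Lemma ext_zero_rreg s t : rreg M (s ++ t) ->
  (forall y, y \in s -> forall v : K, y *: v = 0) ->
  forall i, (i < size s)%N -> ext_zero i (smod M t).
Proof.
elim/last_ind: s t => // s y IHs t; rewrite cat_rcons => reg sK i.
have yK : forall v : K, y *: v = 0 by apply: sK; rewrite mem_rcons mem_head.
rewrite size_rcons; case: i => [_|i lti]; first exact: ext_zero0 yK (rreg_cat reg).
apply: (ext_zeroS yK (rreg_cat reg)); apply: (IHs (y :: t)) => // z zs.
by apply: sK; rewrite mem_rcons inE zs orbT.
Qed.

Lemma ext_cyclic_rreg s t : rreg M (s ++ t) ->
  (forall y, y \in s -> forall v : K, y *: v = 0) ->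
  ext_cyclic (size s) (smod M t) -> ext_cyclic 0 (smod M (s ++ t)).
Proof.
elim/last_ind: s t => // s y IHs t; rewrite cat_rcons => reg sK.
have yK : forall v : K, y *: v = 0 by apply: sK; rewrite mem_rcons mem_head.
rewrite size_rcons => cyc; apply: (IHs (y :: t)) => // [z zs|].
  by apply: sK; rewrite mem_rcons inE zs orbT.
apply: (ext_cyclic_step yK (rreg_cat reg)) => //.
apply: (@ext_zero_rreg (rcons s y)); rewrite ?cat_rcons ?size_rcons //.
Qed.
End ExtCochains.

(** * The socle as Ext in degree zero *)

Section Socle.
Variables (R : comNzRingType) (m : idealr R) (M : lmodType R).
Local Notation k := (residue_field m).

Definition res (a : R) : k := quotmod_pi (ideal_submod m) a.

Lemma res_scale a b : a *: res b = res (a * b).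
Proof. exact: quotmod_piZ. Qed.

Lemma res0 a : res a = 0 <-> a \in m.
Proof.
have -> : 0 = res 0 by rewrite -[0 in RHS](mul0r 1) -res_scale scale0r.
split=> [/eqP|am]; first by rewrite (@quotmod_piE _ R^o) subr0.
by apply/eqP; rewrite (@quotmod_piE _ R^o) subr0.
Qed.

Lemma res_surj v : exists a, v = res a.
Proof. by exists (quotmod_repr v); rewrite /res quotmod_reprK. Qed.

(* The quotient M / N has a one-dimensional socle, spanned by the class of w. *)
Definition socle_gen (N : subm M) (w : M) : Prop :=
  [/\ ~ N w, forall a, a \in m -> N (a *: w)
    & forall v, (forall a, a \in m -> N (a *: v)) -> exists r, N (v - r *: w)].

Lemma ext_cyclic_socle (P : proj_resolution k) (N : subm M) :
  ext_cyclic P 0 N -> exists w, socle_gen N w.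
Proof.
have [p0 p0E] := pr_aug_surj P (res 1).
have [|p pE] := @linear_map R R^o k res.
  by move=> a u v; rewrite /res quotmod_piD -quotmod_piZ.
(* [phi] lifts the augmentation to R, so a socle element v yields the cochain sending x to
   [phi x *: v]. *)
have [|phi phiE] := @proj_lift R (pr_obj P 0) R^o k p (pr_aug P) (@pr_projective _ _ P 0).
  by move=> x; have [a ->] := res_surj (pr_aug P x); exists a; rewrite pE.
have {}phiE x : res (phi x) = pr_aug P x by rewrite -pE.
move=> [f0 [f0coc f0nb f0gen]]; exists (f0 p0).
have mp0 a : a \in m -> N (a *: f0 p0).
  move=> /res0 am; rewrite -linearZ.
  have /pr_exact0[x ->//] : pr_aug P (a *: p0) = 0.
  by rewrite linearZ /= p0E res_scale mulr1.
split=> // [Nw|v mv].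
  apply: (f0nb \0) => // x; rewrite subr0.
  have [a xa] := res_surj (pr_aug P x).
  have /pr_exact0[z zE] : pr_aug P (x - a *: p0) = 0.
    by rewrite linearB linearZ /= p0E res_scale mulr1 xa subrr.
  have -> : f0 x = f0 (pr_diff P 0 z) + a *: f0 p0.
    by rewrite -zE linearB linearZ /= subrK.
  by apply: submD => //; apply: submZ.
have [|f fE] := @linear_map R (pr_obj P 0) M (fun x => phi x *: v).
  by move=> c x y; rewrite linearP /= scalerDl scalerA.
have [x|r [u [u0 Hu]]] := f0gen f.
  rewrite fE; apply/mv/res0; rewrite phiE.
  by apply/pr_exact0; exists x.
exists r; have := Hu p0; rewrite u0 subr0 fE => Hp.
rewrite -[v](subrK (phi p0 *: v)) -addrA; apply: submD => //.
rewrite -[X in X - _]scale1r -scalerBl; apply/mv/res0.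
have -> : res (1 - phi p0) = p (1 - phi p0) by rewrite pE.
by rewrite linearB /= !pE phiE p0E subrr.
Qed.

Lemma coboundary_bound (P : proj_resolution k) t (g : pr_obj P t -> M) :
  g \in @coboundary_at _ _ P M t <->
  exists u : {linear pr_obj P t -> M}, bound u /\ g =1 u.
Proof.
case: t g => [|t] g /=; split=> [/asboolP|].
- by move=> ->; exists \0.
- by move=> [u [u0 gu]]; apply/asboolP/funext => x; rewrite gu u0.
- by move=> [h ->]; exists (h \o pr_diff P t); split=> //; exists h.
by move=> [u [[h uE] gu]]; apply/asboolP; exists h; apply/funext => x; rewrite gu uE.
Qed.

Lemma Ext_cyclic (P : proj_resolution k) t :
  lmod_iso (Ext P M t) {ffun 'I_1 -> k} -> ext_cyclic P t (zero_subm M).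
Proof.
rewrite /lmod_iso => -[F [G FK GK]].
have inF : injective F := can_inj FK.
pose piE (z : submod (@cocycle _ _ P M t)) : Ext P M t :=
  quotmod_pi (@coboundary _ _ P M t) z.
have piEZ a z z' : piE z = a *: piE z' <-> val (z - a *: z') \in @coboundary_at _ _ P M t.
  have -> : a *: piE z' = piE (a *: z') by exact: quotmod_piZ.
  by split=> [/eqP|H]; [|apply/eqP]; rewrite quotmod_piE.
pose z0 := quotmod_repr (G [ffun=> res 1]) : submod (@cocycle _ _ P M t).
have z0K : F (piE z0) = [ffun=> res 1] by rewrite /piE quotmod_reprK GK.
have /asboolP[lz0 z0coc] := valP z0.
have [f0 f0E] := linear_map lz0.
exists f0; split=> [x|u bu f0u|f fcoc].
- by rewrite f0E z0coc.
- have : piE z0 = 0 *: piE z0.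
    apply/piEZ; rewrite scale0r subr0; apply/coboundary_bound.
    exists u; split=> // x; apply/eqP; rewrite -f0E -subr_eq0; apply/eqP/f0u.
  rewrite scale0r => z00; move: z0K; rewrite z00 linear0 => /ffunP/(_ ord0).
  by rewrite !ffunE => /esym/res0; rewrite idealr1.
have fc : (f : pr_obj P t -> M) \in @cocycle _ _ P M t.
  by apply/asboolP; split=> //; exact: linearP.
pose z : submod (@cocycle _ _ P M t) := exist _ (f : _ -> _) fc.
have [r rE] := res_surj (F (piE z) ord0).
have : piE z = r *: piE z0.
  apply: inF; rewrite linearZ /= z0K; apply/ffunP => i.
  by rewrite !ffunE ord1 rE res_scale mulr1.
move/piEZ/coboundary_bound => [u [bu uE]]; exists r, u; split=> // x.
rewrite -uE f0E.
have -> : val (z - r *: z0) = val z - r *: val z0.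
  by rewrite -[val (z - _)]/(val z - val (r *: z0)).
by rewrite subrr.
Qed.
End Socle.

(** * Relative injective dimension *)

Section RelativeInjectives.
Variable R : comNzRingType.

(** Modules over R/(J) are treated as R-modules killed by J, so that no change of rings is
    needed. *)
Definition killed (J : seq R) (V : lmodType R) : Prop :=
  forall a, a \in J -> forall v : V, a *: v = 0.

Definition rel_injective (J : seq R) (E : lmodType R) : Prop :=
  killed J E /\
  forall (A B : lmodType R) (i : {linear A -> B}) (g : {linear A -> E}),
    killed J A -> killed J B -> injective i ->
    exists h : {linear B -> E}, forall a, h (i a) = g a.

Definition ses (A B C : lmodType R) (i : {linear A -> B}) (p : {linear B -> C}) :=
  [/\ injective i, forall c, exists b, p b = c
    & forall b, p b = 0 <-> exists a, b = i a].

(* M has injective dimension at most n as a module over R / (J). *)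
Fixpoint injdim_le (n : nat) (J : seq R) (M : lmodType R) : Prop :=
  match n with
  | 0 => rel_injective J M
  | n'.+1 => exists (E C : lmodType R) (i : {linear M -> E}) (p : {linear E -> C}),
      [/\ rel_injective J E, ses i p & injdim_le n' J C]
  end.

Lemma linear_inj0 (A B : lmodType R) (i : {linear A -> B}) :
  (forall a, i a = 0 -> a = 0) -> injective i.
Proof.
move=> i0 a b ab; apply/eqP; rewrite -subr_eq0; apply/eqP/i0.
by rewrite linearB ab subrr.
Qed.

Lemma factor (A B C : lmodType R) (p : {linear A -> B}) (f : {linear A -> C}) :
  (forall b, exists a, p a = b) -> (forall a, p a = 0 -> f a = 0) ->
  exists g : {linear B -> C}, forall a, g (p a) = f a.
Proof.
move=> surj kerf.
have [|||g gE] := @graph_linear R B C (fun b c => exists2 a, p a = b & f a = c).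
- by move=> b; have [a ab] := surj b; exists (f a), a.
- move=> c _ _ _ _ [a <- <-] [a' <- <-]; exists (c *: a + a'); exact: linearP.
- by move=> c [a /kerf-> ->].
exists g => a; have [a' aa' <-] := gE (p a).
by apply/eqP; rewrite -subr_eq0 -linearB kerf // linearB aa' subrr.
Qed.

Lemma ses_comp0 (A B C : lmodType R) (i : {linear A -> B}) (p : {linear B -> C}) a :
  ses i p -> p (i a) = 0.
Proof. by case=> _ _ ex; apply/ex; exists a. Qed.

Lemma killed_inj J (A B : lmodType R) (i : {linear A -> B}) :
  injective i -> killed J B -> killed J A.
Proof. by move=> inji kB a aJ v; apply: inji; rewrite linearZ linear0 /= kB. Qed.

Lemma killed_ideal J (V : lmodType R) (a : R) (v : V) :
  killed J V -> ideal_of J a -> a *: v = 0.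
Proof.
move=> kV /(smod_scale v).
by apply: (smod_min (N := zero_subm V)) => z u zJ; apply: kV.
Qed.

Lemma rel_injective_retract J (W E : lmodType R) (w : {linear W -> E})
  (r : {linear E -> W}) : cancel w r -> rel_injective J E -> rel_injective J W.
Proof.
move=> wK [kE injE]; split; first exact: killed_inj (can_inj wK) kE.
move=> A B i g kA kB inji; have [h hE] := injE A B i (w \o g) kA kB inji.
by exists (r \o h) => a /=; rewrite hE /= wK.
Qed.

(** Injectivity of A splits the sequence, so C is a retract of B. *)
Lemma rel_injective_quot J (A B C : lmodType R) (i : {linear A -> B})
  (p : {linear B -> C}) :
  ses i p -> rel_injective J A -> rel_injective J B -> rel_injective J C.
Proof.
move=> sip [kA injA] injB; have [inji surj ex] := sip.
have [|rho rhoE] := injA A B i idfun kA _ inji; first by have [] := injB.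
have [//|b /ex[a ->]|sigma sE] := @factor B C B p (idfun \- (i \o rho)).
  by rewrite /= rhoE subrr.
apply: (rel_injective_retract (w := sigma) (r := p)) injB => c.
have [b <-] := surj c; rewrite sE /= linearB /=.
by rewrite (ses_comp0 _ sip) subr0.
Qed.

(** Replace the injective hull term E of B by E/A, which is again injective and contains C with the
    same cokernel. *)
Lemma injdim_le_quot n J (A B C : lmodType R) (i : {linear A -> B})
  (p : {linear B -> C}) :
  ses i p -> rel_injective J A -> injdim_le n J B -> injdim_le n J C.
Proof.
case: n => [|n]; first exact: rel_injective_quot.
move=> sip injA [E [D [j [q [injE sjq nD]]]]].
have [inji surjp exp] := sip; have [injj surjq exq] := sjq.
have [F [t [surjt tE]]] := quot_exists (range_subm (j \o i)).
have sjt : ses (j \o i) t.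
  by split=> //; move=> a b /injj/inji.
have [//|b /exp[a ->]|j' j'E] := @factor B C F p (t \o j).
  by apply/tE; exists a.
have [//|e /tE[a ->]|q' q'E] := @factor E F D t q.
  by rewrite /= (ses_comp0 _ sjq).
exists F, D, j', q'; split=> //; first exact: rel_injective_quot sjt injA injE.
split.
- apply: linear_inj0 => c; have [b <-] := surjp c; rewrite j'E => /tE[a /injj->].
  exact: ses_comp0 sip.
- by move=> x; have [e <-] := surjq x; exists (t e).
move=> f; have [e <-] := surjt f; rewrite q'E; split=> [/exq[b ->]|[c]].
  by exists (p b); rewrite j'E.
have [b <-] := surjp c; rewrite j'E => teb.
have /tE[a eE] : t (e - j b) = 0 by rewrite linearB teb subrr.
apply/exq; exists (i a + b).
by rewrite linearD -[j (i a)]/((j \o i) a) -eE subrK.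
Qed.

(** Extend the map from R/(J) sending 1 to e along multiplication by y, which is injective on
    R/(J). *)
Lemma rel_injective_div J (E : lmodType R) y : rel_injective J E ->
  (forall a, ideal_of J (y * a) -> ideal_of J a) ->
  forall e : E, exists e', y *: e' = e.
Proof.
move=> [kE injE] yreg e; have [A [p [surj pE]]] := quot_exists (ideal_of J).
have kA : killed J A.
  move=> a aJ v; have [u <-] := surj v; rewrite -linearZ; apply/pE.
  exact: smod_mul.
have [f fE] := scale_linear e.
have [//|a /pE Ja|g gE] := @factor R^o A E p f.
  by rewrite fE; apply: killed_ideal Ja.
have [|my myE] := @linear_map R A A (fun a => y *: a).
  by move=> c u v; rewrite scalerDr !scalerA mulrC.
have [//|//||h hE] := injE A A my g.
  apply: linear_inj0 => a; have [b <-] := surj a.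
  by rewrite myE -linearZ => /pE/yreg/pE.
by exists (h (p 1)); rewrite -linearZ -myE hE gE fE scale1r.
Qed.

Lemma rel_injective_tors J y (C T : lmodType R) (i : {linear T -> C}) :
  injective i -> (forall c, y *: c = 0 <-> exists t, c = i t) ->
  rel_injective J C -> rel_injective (y :: J) T.
Proof.
move=> inji iT [kC injC]; split.
  move=> a; rewrite inE => /orP[/eqP-> v|aJ v]; apply: inji.
    by rewrite linearZ linear0; apply/iT; exists v.
  by rewrite linearZ linear0 /= kC.
move=> A B j g kA kB injj.
have sJ V : killed (y :: J) V -> killed J V.
  by move=> kV a aJ; apply: kV; rewrite inE aJ orbT.
have [h hE] := injC A B j (i \o g) (sJ _ kA) (sJ _ kB) injj.
have [//|b|h' h'E] := @corestrict R B T C i h.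
  by apply/iT; rewrite -linearZ kB ?mem_head ?linear0.
by exists h' => a; apply: inji; rewrite -h'E hE.
Qed.

Definition tors (y : R) (V : lmodType R) : subm V.
Proof.
exists (fun v => y *: v = 0); first exact: scaler0.
by move=> a u v u0 v0; rewrite scalerDr scalerA mulrC -scalerA u0 v0 scaler0 addr0.
Defined.

Section Change.
Variables (J : seq R) (y : R).
Hypothesis yreg : forall a, ideal_of J (y * a) -> ideal_of J a.

(** Divisibility of C keeps the sequence of y-torsion submodules exact on the right, and
    divisibility passes to the next cokernel. *)
Lemma injdim_le_tors n (C T : lmodType R) (i : {linear T -> C}) :
  injective i -> (forall c, y *: c = 0 <-> exists t, c = i t) ->
  (forall c : C, exists c', y *: c' = c) ->
  injdim_le n J C -> injdim_le n (y :: J) T.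
Proof.
elim: n C T i => [|n IHn] C T i inji iT divC; first exact: rel_injective_tors iT.
move=> [E [D [j [p [injE [injj surjp exp] nD]]]]].
have divE := rel_injective_div injE yreg.
have divD (x : D) : exists x', y *: x' = x.
  have [e <-] := surjp x; have [e' <-] := divE e; exists (p e').
  by rewrite linearZ.
have [ET [iE [injiE ETE]]] := sub_exists (tors y E).
have [DT [iD [injiD DTE]]] := sub_exists (tors y D).
have [//|t|j' j'E] := @corestrict R T ET E iE (j \o i).
  by apply/ETE => /=; rewrite -linearZ (iT _).2 ?linear0 //; exists t.
have [//|e|p' p'E] := @corestrict R ET DT D iD (p \o iE).
  by apply/DTE => /=; rewrite -linearZ (ETE _).2 ?linear0 //; exists e.
exists ET, DT, j', p'; split.
- exact: rel_injective_tors injiE ETE injE.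
- split.
  + apply: linear_inj0 => t jt; apply: inji; apply: injj; rewrite !linear0.
    by rewrite -[j (i t)]/((j \o i) t) j'E jt linear0.
  + move=> x; have [e pe] := surjp (iD x).
    have /exp[c ce] : p (y *: e) = 0.
      by rewrite linearZ /= pe; apply/DTE; exists x.
    have [c' cc'] := divC c.
    have /ETE[t tE] : tors y E (e - j c').
      by rewrite /= scalerBr ce -cc' linearZ subrr.
    exists t; apply: injiD; rewrite -p'E /= -tE linearB /= pe.
    by rewrite (exp _).2 ?subr0 //; exists c'.
  + move=> e; split=> [pe|[t ->]].
      have /exp[c ec] : p (iE e) = 0.
        by rewrite -[p (iE e)]/((p \o iE) e) p'E pe linear0.
      have /iT[t ct] : y *: c = 0.
        by apply: injj; rewrite linear0 linearZ /= -ec; apply/ETE; exists e.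
      by exists t; apply: injiE; rewrite -j'E /= -ct.
    apply: injiD; rewrite -p'E /= -j'E linear0; apply/exp.
    by exists (i t).
exact: IHn injiD DTE divD nD.
Qed.

(** As M has no y-torsion and E is y-divisible, the snake lemma gives 0 -> E[y] -> C[y] -> M/yM ->
    0, where E[y] is injective over R/(y, J). If M itself is injective, it is divisible and M/yM =
    0. *)
Lemma injdim_le_mod n (M M' : lmodType R) (q : {linear M -> M'}) :
  (forall v : M, y *: v = 0 -> v = 0) -> (forall v', exists v, q v = v') ->
  (forall v, q v = 0 <-> exists u, v = y *: u) ->
  injdim_le n J M -> exists n', injdim_le n' (y :: J) M'.
Proof.
move=> Mreg surjq qE; case: n => [|n].
  move=> injM; have M'0 (v' : M') : v' = 0.
    have [v <-] := surjq v'; have [u <-] := rel_injective_div injM yreg v.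
    by apply/qE; exists u.
  exists 0%N; split=> [a aJ v|A B i g _ _ _]; first exact: M'0.
  by exists \0 => a; rewrite [RHS]M'0.
move=> [E [C [j [p [injE sjp nC]]]]]; have [injj surjp exp] := sjp.
have divE := rel_injective_div injE yreg.
have divC (x : C) : exists x', y *: x' = x.
  have [e <-] := surjp x; have [e' <-] := divE e; exists (p e').
  by rewrite linearZ.
have [ET [iE [injiE ETE]]] := sub_exists (tors y E).
have [CT [iC [injiC CTE]]] := sub_exists (tors y C).
have [//|e|f fE] := @corestrict R ET CT C iC (p \o iE).
  by apply/CTE => /=; rewrite -linearZ (ETE _).2 ?linear0 //; exists e.
have kE e : y *: iE e = 0 by apply/ETE; exists e.
have kC c : y *: iC c = 0 by apply/CTE; exists c.
(* The connecting map, given by its graph: lift c to e, and divide y e back into M. *)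
have [|||g gE] := @graph_linear R CT M'
  (fun c v' => exists e x, [/\ iC c = p e, y *: e = j x & v' = q x]).
- move=> c; have [e pe] := surjp (iC c).
  have /exp[x xe] : p (y *: e) = 0 by rewrite linearZ /= pe kC.
  by exists (q x), e, x.
- move=> a c v c' v' [e [x [ce ex ->]]] [e' [x' [ce' ex' ->]]].
  exists (a *: e + e'), (a *: x + x'); rewrite !linearP ce ce' -ex -ex'.
  by split=> //; rewrite scalerDr !scalerA mulrC.
- move=> v [e [x [ce ex ->]]]; rewrite linear0 in ce.
  have /exp[a ea] := esym ce; apply/qE; exists a; apply: injj.
  by rewrite -ex ea linearZ.
have {}gE c e x : iC c = p e -> y *: e = j x -> g c = q x.
  move=> ce ex; have [e' [x' [ce' ex' ->]]] := gE c.
  have /exp[a ea] : p (e' - e) = 0 by rewrite linearB -ce -ce' subrr.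
  apply/eqP; rewrite -subr_eq0 -linearB; apply/eqP/qE; exists a; apply: injj.
  by rewrite linearB -ex -ex' -scalerBr ea linearZ.
have sfg : ses f g.
  split.
  - apply: linear_inj0 => t ft; have /exp[a ta] : p (iE t) = 0.
      by rewrite -[p _]/((p \o iE) t) fE ft linear0.
    apply: injiE; rewrite linear0 ta (Mreg a) ?linear0 //.
    by apply: injj; rewrite linearZ linear0 /= -ta.
  - move=> v'; have [v <-] := surjq v'; have [e ev] := divE (j v).
    have /CTE[c cE] : y *: p e = 0 by rewrite -linearZ ev (ses_comp0 _ sjp).
    by exists c; apply: gE ev.
  - move=> c; split=> [gc|[t ->]]; last first.
      by rewrite (gE _ (iE t) 0) ?linear0 // -fE.
    have [e pe] := surjp (iC c).
    have /exp[x xe] : p (y *: e) = 0 by rewrite linearZ /= pe kC.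
    have /qE[u xu] : q x = 0 by rewrite -(gE c e x).
    have /ETE[t tE] : tors y E (e - j u).
      by rewrite /= scalerBr xe xu linearZ subrr.
    exists t; apply: injiC; rewrite -fE /= -tE linearB /= pe.
    by rewrite (ses_comp0 _ sjp) subr0.
exists n; apply: (injdim_le_quot sfg).
  exact: rel_injective_tors injiE ETE injE.
exact: injdim_le_tors injiC CTE divC nC.
Qed.

End Change.

Lemma injdim_le_rreg (M : lmodType R) s n : rreg R^o s -> rreg M s ->
  injdim_le n [::] M ->
  exists n' (W : lmodType R) (p : {linear M -> W}),
  [/\ forall w, exists v, p v = w, forall v, p v = 0 <-> smod M s v
    & injdim_le n' s W].
Proof.
move=> + + nM; elim: s => [_ _|y s IHs [regR yR] [regM yM]].
  by exists n, M, idfun; split=> // w; exists w.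
have [n' [W [p [surjp pE nW]]]] := IHs regR regM.
have [W' [p' [surjp' p'E]]] := quot_exists (smod M (y :: s)).
have [//|v /pE sv|q qE] := @factor M W W' p p'.
  by apply/p'E; apply: sub_add_mul.
have [||||n'' nW'] := @injdim_le_mod s y _ n' W W' q _ _ _ nW.
- exact: yR.
- move=> w; have [v <-] := surjp w; rewrite -linearZ => /pE/yM sv.
  exact/pE.
- by move=> w'; have [v <-] := surjp' w'; exists (p v).
- move=> w; have [v <-] := surjp w; rewrite qE; split=> [/p'E[u]|[w' vw']].
    by move=> /pE; rewrite linearB linearZ => /eqP; rewrite subr_eq0 => /eqP->; exists (p u).
  have [u uw'] := surjp w'; apply/p'E; exists u; apply/pE.
  by rewrite linearB linearZ /= uw' vw' subrr.
by exists n'', W', p'.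
Qed.

Lemma rel_injective_nil (E : lmodType R) : injective_module E -> rel_injective [::] E.
Proof. by move=> injE; split=> // A B i g _ _; apply: injE. Qed.

Lemma injdim_le_exists (M : lmodType R) : finite_injdim M -> exists n, injdim_le n [::] M.
Proof.
move=> [n [E [e [d [injE inje exe exd En]]]]].
(* [W] is the kernel of [d i] and k counts the remaining steps. At k = 0 the next term is zero, so
   [W] is all of [E i]. *)
suff tail k i (W : lmodType R) (w : {linear W -> E i}) : n = (i + k)%N -> injective w ->
    (forall x, d i x = 0 <-> exists u, x = w u) -> injdim_le k [::] W.
  by exists n; apply: (tail n 0%N M e).
elim: k i W w => [|k IHk] i W w ni injw wE.
  have [r rK] : exists r : {linear E i -> W}, forall x, x = w (r x).
    apply: (corestrict (f := idfun) injw) => x; apply/wE.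
    by apply: En; rewrite ni addn0.
  apply: (rel_injective_retract (w := w) (r := r)).
    by move=> u; apply: injw; rewrite -rK.
  exact/rel_injective_nil/injE.
have [C [c [injc cE]]] := sub_exists (range_subm (d i)).
have [|p pE] := @corestrict R (E i) C (E i.+1) c (d i) injc.
  by move=> x; apply/cE; exists x.
exists (E i), C, w, p; split; first exact/rel_injective_nil/injE.
  split=> // [u|x].
    have /cE[x cx] : exists u', c u = c u' by exists u.
    by exists x; apply: injc; rewrite -pE.
  rewrite -wE pE; split=> [->|]; first by rewrite linear0.
  by rewrite -[0](linear0 c) => /injc.
apply: (IHk i.+1 C c) => //; first by rewrite addSnnS.
by move=> x; rewrite exd -cE.
Qed.

(* Baer's condition for maps from ideals of R / (J) to E, given by their graphs. *)
Definition baer (J : seq R) (E : lmodType R) : Prop :=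
  killed J E /\ forall G : subm (R^o * E)%type,
    (forall a, a \in J -> G (a, 0)) -> (forall e, G (0, e) -> e = 0) ->
    exists e0 : E, forall (a : R) e, G (a, e) -> e = a *: e0.

(** The quotient B of R + E by G is a pushout containing E. A retraction of B onto E, evaluated at
    the class of (1, 0), gives [e0] up to sign. *)
Lemma rel_injective_baer J (E : lmodType R) : rel_injective J E -> baer J E.
Proof.
move=> [kE injE]; split=> // G GJ G0.
have [B [p [surj pE]]] := quot_exists G.
have kB : killed J B.
  move=> z zJ v; have [[a e] <-] := surj v; rewrite -linearZ; apply/pE.
  have -> : z *: (a, e) = a *: ((z : R^o), (0 : E)).
    by congr (_, _) => /=; [rewrite /GRing.scale /= mulrC|rewrite kE // scaler0].
  by apply/submZ/GJ.
have [|i iE] := @linear_map R E B (fun e => p (0, e)).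
  move=> a u v; rewrite -linearP; congr (p _).
  by congr (_, _); rewrite /= ?scaler0 ?addr0.
have [//|//||h hE] := injE E B i idfun.
  by apply: linear_inj0 => e; rewrite iE => /pE/G0.
exists (- h (p (1, 0))) => a e /pE Gae.
rewrite scalerN -linearZ -linearZ; apply/eqP; rewrite -addr_eq0.
rewrite -[e in X in X == _]hE iE -!linearD.
have -> : (0, e) + a *: ((1 : R^o), (0 : E)) = (a, e).
  by congr (_, _) => /=; [rewrite add0r /GRing.scale /= mulr1|rewrite scaler0 addr0].
by rewrite Gae linear0.
Qed.

(** The hypothesis makes the map on K + Rb that kills K and sends b to w well defined. *)
Lemma baer_extend J (E : lmodType R) (K : ideal R) b w : baer J E ->
  (forall a, a \in J -> K a) -> (forall r, K (r * b) -> r *: w = 0) ->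
  exists e : E, (forall t, K t -> t *: e = 0) /\ b *: e = w.
Proof.
move=> [kE baerE] JK Kb.
pose G (z : R^o * E) := exists r : R, K (z.1 - r * b) /\ z.2 = r *: w.
have G00 : G 0 by exists 0; rewrite mul0r subr0 scale0r; split=> //; exact: subm0.
have GP c u v : G u -> G v -> G (c *: u + v).
  move=> [r [Ku uE]] [r' [Kv vE]]; exists (c * r + r'); split.
    change (K (c * u.1 + v.1 - (c * r + r') * b)).
    rewrite mulrDl opprD -mulrA addrACA -mulrBr; exact: submP.
  by rewrite /= uE vE scalerDl scalerA.
have [||e0 e0E] := baerE (Subm G00 GP).
- by move=> a /JK Ka; exists 0; rewrite mul0r subr0 scale0r.
- by move=> e [r []]; rewrite sub0r /= => /submN; rewrite opprK => /Kb-> ->.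
exists e0; split=> [t Kt|].
  by rewrite -(e0E t 0) //; exists 0; rewrite mul0r subr0 scale0r.
rewrite -(e0E b w) //; exists 1; rewrite mul1r subrr scale1r; split=> //.
exact: subm0.
Qed.

(** R/(J) is local with nilpotent maximal ideal ([zs]). *)
Definition artin (J zs : seq R) : Prop :=
  [/\ local_gen zs, forall a, a \in J -> ideal_of zs a
    & forall z, z \in zs -> exists n, ideal_of J (z ^+ n)].

Lemma artin_nilp J zs (V : lmodType R) (N : subm V) : artin J zs ->
  (forall a v, a \in J -> N (a *: v)) -> nilp N zs.
Proof.
move=> [_ _ nil] JN z /nil[n Jzn]; exists n => v.
exact: (smod_min JN) (smod_scale _ Jzn).
Qed.

Lemma artin_unit J zs (K : ideal R) b r : artin J zs -> ~ K b -> K (r * b) ->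
  ideal_of zs r.
Proof.
move=> [[_ loc] _ _] Kb Krb; case: (loc r) => // -[r' r'r]; case: Kb.
by rewrite -[b]mul1r -r'r -mulrA; apply: (@submZ R R^o).
Qed.

Section ArtinianDescent.
Variables (J zs : seq R) (C E F : lmodType R) (i : {linear C -> E}) (p : {linear E -> F}).
Hypotheses (Jzs : artin J zs) (baerE : baer J E) (baerF : baer J F) (sip : ses i p).

(** This is the annihilator of [p e] in F. *)
Definition conductor (e : E) : ideal R.
Proof.
exists (fun a : R => range_subm i (a *: e)).
  by rewrite scale0r; apply: subm0.
by move=> a u v; rewrite scalerDl -scalerA; apply: submP.
Defined.

(** Let s be a nonzero socle element of R/(J). Injectivity of F writes [p (b *: e)] as s g; lifting
    g to [e1] leaves b e - s e1 in C. Since the maximal ideal kills s e1, injectivity of E gives an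
    element killed by the conductor of e that b sends to s e1; subtract it from e. *)
Lemma conductor_extend e (b : R) :
  (forall a : R, ideal_of zs a -> conductor e (a * b)) ->
  exists e' : E, (forall t, conductor e t -> t *: e' = 0) /\ conductor (e + e') b.
Proof.
move=> mb; have [|eb] := pselect (conductor e b).
  move=> eb; exists 0; split=> [t _|]; rewrite ?scaler0 //.
  by change (conductor (e + 0) b); rewrite addr0.
have [kE _] := baerE; have [inji surjp exp] := sip.
have [loc Jm _] := Jzs.
have condJ (t : R) : ideal_of J t -> conductor e t.
  by move=> Jt; exists 0; rewrite linear0 (killed_ideal _ kE Jt).
have nilJ : nilp (ideal_of J) zs.
  by apply: (artin_nilp Jzs) => a v aJ; apply: (@smod_mul _ R^o).
have [|s [Js sm]] := @socle_mod R R^o (ideal_of J) zs 1 nilJ.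
  move=> J1; have [zs1 _] := loc; apply: zs1.
  apply: (smod_min (N := ideal_of zs)) J1 => a v aJ.
  by rewrite [_ *: _]mulrC; apply/(@submZ R R^o)/Jm.
have {s Js sm} [s [Js sm]] : exists s : R, (~ ideal_of J s) /\
    (forall a : R, ideal_of zs a -> ideal_of J (a * s)%R).
  exists (s *: (1 : R^o)); exact: (conj Js sm).
have [|r Jr|g [_ gE]] := @baer_extend J F (ideal_of J) s (p (b *: e)) baerF.
- exact: ideal_of_mem.
- have [c cE] := mb _ (artin_unit Jzs Js Jr).
  by rewrite -linearZ scalerA cE (ses_comp0 _ sip).
have [e1 e1g] := surjp g.
have /exp[c cE] : p (b *: e - s *: e1) = 0 by rewrite linearB [p (s *: _)]linearZ /= e1g gE subrr.
have [|r cr|e' [e'E be']] := @baer_extend J E (conductor e) b (s *: e1) baerE.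
- by move=> a /ideal_of_mem/condJ.
- rewrite scalerA; apply: (killed_ideal _ kE).
  by apply: sm; apply: artin_unit Jzs eb cr.
exists (- e'); split=> [t /e'E|]; first by rewrite scalerN => ->; rewrite oppr0.
by exists c; rewrite -cE scalerDr scalerN be'.
Qed.

(* Call b reachable if any e can be corrected, without changing its products
   with elements of its conductor, so that b enters the conductor.  An element is
   reachable as soon as its multiples by the generators of the maximal ideal
   are, so an unreachable 1 would contradict socle_ring. *)
Lemma baer_descent : baer J C.
Proof.
have [kE Eext] := baerE; have [inji surjp exp] := sip.
split=> [|G GJ G0]; first exact: killed_inj inji kE.
pose reach b := forall e, exists e' : E,
  (forall t, conductor e t -> t *: e' = 0) /\ conductor (e + e') b.
have mono e e' : (forall t, conductor e t -> t *: e' = 0) ->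
    forall t, conductor e t -> conductor (e + e') t.
  by move=> e'0 t et; rewrite /conductor /= scalerDr e'0 // addr0.
have reach1 : reach 1.
  apply: contrapT => nreach; have [||//|b [nb zb]] := @socle_ring R reach zs.
  - move=> a b rb e; have [e' [e'0 be']] := rb e; exists e'; split=> //.
    exact: (@submZ R R^o).
  - move=> z zzs; have [_ _ nil] := Jzs; have [n Jzn] := nil z zzs.
    exists n => b e; exists 0; split=> [t|]; first by rewrite scaler0.
    rewrite addr0; exists 0; rewrite linear0 -scalerA.
    exact: killed_ideal kE Jzn.
  apply: nb => e.
  (* Corrections are made generator by generator; [mono] preserves what earlier ones achieved. *)
  have [e' [e'0 zse']] : exists e' : E, (forall t, conductor e t -> t *: e' = 0) /\
      forall z, z \in zs -> conductor (e + e') (z * b).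
    elim: zs zb => [|z ws IHws] wsb; first by exists 0; split=> // t _; rewrite scaler0.
    have [|e' [e'0 wse']] := IHws; first by move=> w wws; apply: wsb; rewrite inE wws orbT.
    have [|e'' [e''0 ze'']] := wsb z _ (e + e'); first by rewrite mem_head.
    exists (e' + e''); rewrite addrA; split=> [t et|w].
      by rewrite scalerDr e'0 // e''0 ?addr0 //; apply: mono.
    by rewrite inE => /orP[/eqP->//|/wse' we]; apply: mono.
  have [|e'' [e''0 be'']] := @conductor_extend (e + e') b.
    move=> a; have [f fE] := scale_linear (b : R^o).
    have -> : a * b = f a by rewrite fE.
    apply: (smod_min (N := comap f (conductor (e + e')))) => z c zzs.
    change (conductor (e + e') (f (z * c))); rewrite fE mulrC -scalerA.
    by apply: submZ; apply: zse'.
  exists (e' + e''); rewrite addrA; split=> // t et.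
  by rewrite scalerDr e'0 // e''0 ?addr0 //; apply: mono.
pose GE (z : R^o * E) := exists c, G (z.1, c) /\ z.2 = i c.
have GE0 : GE 0 by exists 0; split; [exact: (subm0 G)|rewrite (linear0 i)].
have GEP a u v : GE u -> GE v -> GE (a *: u + v).
  move=> [c [Gc cE]] [c' [Gc' c'E]]; exists (a *: c + c'); split.
    exact: (submP a Gc Gc').
  by rewrite (linearP i) -cE -c'E.
have [||e eE] := Eext (Subm GE0 GEP).
- by move=> a aJ; exists 0; rewrite linear0; split=> //; apply: GJ.
- by move=> e [c /= [/G0-> ->]]; rewrite linear0.
(* With 1 in its conductor, e + e' lies in C. It still induces [G], whose domain lies in the
   conductor of e and so kills e'. *)
have [e' [e'0 [c0 c0E]]] := reach1 e; exists c0 => a c Gac.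
have aeE : i c = a *: e by apply: eE; exists c.
apply: inji; rewrite linearZ /= -c0E scale1r scalerDr -aeE e'0 ?addr0 //.
by exists c; rewrite -aeE.
Qed.
End ArtinianDescent.

Lemma injdim_le_baer n J zs (M : lmodType R) : artin J zs -> injdim_le n J M -> baer J M.
Proof.
move=> Jzs; elim: n M => [|n IHn] M; first exact: rel_injective_baer.
move=> [E [C [i [p [injE sip /IHn nC]]]]].
exact: baer_descent Jzs (rel_injective_baer injE) nC sip.
Qed.
End RelativeInjectives.

(** * Reductions generated by a regular sequence *)

Section Exchange.
Variables (R : comNzRingType) (zs ws : seq R) (Q I Ir Ip : ideal R) (n : nat).
Hypotheses (nR : noeth R^o) (loc : local_gen zs).
Hypothesis Im : forall a, I a -> ideal_of zs a.
Hypotheses (wsreg : rreg R^o ws) (wsI : forall w, w \in ws -> exists k, I (w ^+ k)).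
Hypothesis QI : forall a, Q a -> I a.
Hypothesis IIr : forall a b : R, I a -> Ir b -> Ip (a * b).
Hypothesis QIr : forall U : ideal R, (forall q b : R, Q q -> Ir b -> U (q * b)) ->
  forall p, Ip p -> U p.
Hypothesis IpX : forall a : R, I a -> Ip (a ^+ n).

(** [Ir] and [Ip] stand for I^r and I^(r+1) = Q I^r. If Q lay in (us) + m y, then [Ip] would lie in
    (us) + m [Ip], hence in (us), and [few_generators] would make (us) the unit ideal. *)
Lemma reduction_not_small y (us : seq R) : (size us < size ws)%N ->
  I y -> (forall u, u \in us -> I u) ->
  ~ (forall q, Q q -> exists c : R, ideal_of zs c /\ ideal_of us (q - c * y)).
Proof.
move=> ltus Iy Ius Qus; have [g [gIp Ipg]] := nR Ip.
have gus : forall v, v \in g -> ideal_of us v.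
  apply: (nakayama loc) => v /gIp; apply: QIr => q b /Qus[c [mc usq]] Irb.
  rewrite -[q](subrK (c * y)) mulrDl -mulrA; apply: submD.
    by apply: sub_lin; rewrite mulrC; apply: (@submZ R R^o).
  apply: lin_scale mc (Ipg _ (IIr Iy Irb)) => u ->; exact: subm0.
have Ipus a : Ip a -> ideal_of us a.
  by move/Ipg; apply: lin_min => [u ->|c u _ /gus]; [exact: subm0|exact: submZ].
have us1 : ideal_of us 1.
  apply: (few_generators _ wsreg) ltus => w /wsI[k Iwk].
  by exists (k * n)%N; rewrite exprM; apply/Ipus/IpX.
case: loc => zs1 _; apply: zs1; apply: (smod_min (N := ideal_of zs)) us1 => u a usu.
by rewrite [_ *: _]mulrC; apply/(@submZ R R^o)/Im/Ius.
Qed.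

(** The list [xs] holds elements of Q already exchanged. Some element of Q has a unit coefficient at
    the head of [ys], and replaces it. *)
Lemma reduction_exchange (ys xs : seq R) : (forall x, x \in xs -> Q x) ->
  (size ys + size xs <= size ws)%N ->
  (forall a, I a <-> ideal_of (ys ++ xs) a) -> forall a, I a -> Q a.
Proof.
elim: ys xs => [|y ys IHys] xs Qxs les IE a.
  move/IE; apply: (smod_min (N := Q)) => x b /Qxs.
  by rewrite [_ *: _]mulrC; apply: (@submZ R R^o).
have Iys u : u \in ys ++ xs -> I u.
  by move=> uin; apply/IE/ideal_of_mem; rewrite inE uin orbT.
have Iy : I y by apply/IE/ideal_of_mem; rewrite mem_head.
have := @reduction_not_small y (ys ++ xs); rewrite size_cat => /(_ les Iy Iys).
move/existsNP => [x /not_implyP[Qx /forallNP nx]].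
have /IE[c xc] := QI Qx; rewrite [y *: c]mulrC in xc.
have [mc|[c' c'c]] := loc.2 c; first by case: (nx c).
apply: (IHys (x :: xs)) => [z|/=|b].
- by rewrite inE => /orP[/eqP->|/Qxs].
- by rewrite addnS.
have sub u : u \in ys ++ xs -> u \in ys ++ x :: xs.
  by rewrite !mem_cat inE => /orP[->|->]; rewrite ?orbT.
split=> [/IE|].
  apply: (smod_min (N := ideal_of (ys ++ x :: xs))) => u e.
  rewrite inE [u *: _]mulrC => /orP[/eqP->|/sub/ideal_of_mem]; last exact: (@submZ R R^o).
  apply: (@submZ R R^o); rewrite -[y]mul1r -c'c -mulrA; apply: (@submZ R R^o).
  rewrite -[c * y](subKr x); apply: submB.
    by apply: ideal_of_mem; rewrite mem_cat mem_head orbT.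
  exact: smod_sub xc.
apply: (smod_min (N := I)) => u e.
rewrite mem_cat inE orbCA [u *: _]mulrC => /orP[/eqP->|]; last first.
  by rewrite -mem_cat => /Iys; apply: (@submZ R R^o).
by apply/(@submZ R R^o)/QI.
Qed.

End Exchange.

Section Reduction.
Variable R : comNzRingType.

(** Applied to [ideal_exp], a bare predicate; in this form the induction principle is the definition
    itself. *)
Definition generated (S : R -> Prop) : ideal R.
Proof.
exists (fun a => forall U : ideal R, (forall s, S s -> U s) -> U a).
  by move=> U _; apply: subm0.
by move=> a u v Hu Hv U SU; apply: submP; [exact: Hu|exact: Hv].
Defined.

Definition idealr_subm (I : idealr R) : ideal R.
Proof.
exists (fun a : R => is_true (a \in I)); first exact: rpred0.
by move=> a u v uI vI; apply: rpredD => //; apply: idealMr.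
Defined.

Lemma reduction_eq zs ws (I : idealr R) (x y : seq R) :
  noeth R^o -> local_gen zs -> (forall a, a \in I -> ideal_of zs a) ->
  rreg R^o ws -> (forall w, w \in ws -> exists k, w ^+ k \in I) ->
  reduction (ideal_gen x) I -> I =i ideal_gen y -> (size y <= size ws)%N ->
  forall a, a \in I -> a \in ideal_gen x.
Proof.
move=> nR loc Im wsreg wsI [xI [r redr]] Iy ley a aI; apply/ideal_ofE.
pose Ir := generated (fun b => b \in ideal_exp I r).
pose Ip := generated (fun b => b \in ideal_exp I r.+1).
apply: (@reduction_exchange R zs ws (ideal_of x) (idealr_subm I) Ir Ip r.+1
  nR loc Im wsreg wsI _ _ _ _ y [::]) aI => //=.
- by move=> b /ideal_ofE/xI.
- move=> b c bI Irc.
  have [|f fE] := @linear_map R R^o R^o (fun c => b * c).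
    by move=> e u v; rewrite mulrDr; congr (_ + _); apply: mulrCA.
  rewrite -fE; apply: (Irc (comap f Ip)) => s sIr /=; rewrite fE => U; apply.
  apply/asboolP; exists 1%N, (fun=> b), (fun=> s); split=> //.
  by rewrite big_ord1.
- move=> U QU p Ipp; apply: Ipp => s; rewrite -redr => /asboolP[k [e [w [eQ wI ->]]]].
  by apply: subm_sum => i _; apply: QU; [apply/ideal_ofE|move=> V; apply].
- move=> b bI U; apply; elim: {redr Ir Ip U}r => [|r IHr]; apply/asboolP.
    by exists 1%N, (fun=> b), (fun=> 1); split=> //; rewrite big_ord1 [_ *: _]mulr1.
  exists 1%N, (fun=> b), (fun=> b ^+ r.+1); split=> //.
  by rewrite big_ord1 exprS.
- by rewrite addn0.
- by move=> b; rewrite cats0 -ideal_ofE -Iy.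
Qed.
End Reduction.

(** * Gorenstein ideals and the canonical module *)

Lemma free_rank1 (A : comNzRingType) (V : lmodType A) (w : V) :
  (forall a, a *: w = 0 -> a = 0) -> (forall v, exists a, v = a *: w) ->
  free_module V.
Proof.
move=> w0 wV; exists 1%N.
have [v||u|f fE] := @graph_linear A V 'rV[A]_1 (fun v u => v = u 0 0 *: w).
- by have [a ->] := wV v; exists (const_mx a); rewrite mxE.
- by move=> a v u v' u' -> ->; rewrite !mxE scalerDl scalerA.
- by move=> /esym/w0 u0; apply/rowP => j; rewrite ord1 u0 mxE.
exists f; exists (fun u : 'rV[A]_1 => u 0 0 *: w) => [v|u]; first by rewrite -fE.
apply/rowP => j; rewrite ord1; apply/eqP; rewrite -subr_eq0; apply/eqP/w0.
by rewrite scalerBl -fE subrr.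
Qed.

Section Quotients.
Local Open Scope quotient_scope.
Variables (R : comNzRingType) (I : idealr R).
Local Notation A := {ideal_quot I}.
Local Notation piA := (\pi_{ideal_quot I}).

Lemma pi_eq0 (a : R) : piA a = 0 :> A <-> a \in I.
Proof.
have -> : (a \in I) = (piA a == piA 0) by rewrite -{1}[a]subr0 Quotient.idealrBE.
by rewrite rmorph0; split=> [->|/eqP].
Qed.

Lemma free_redmod (M : lmodType R) (w : M) :
  (forall a : R, a *: w \in smulT M I -> a \in I) ->
  (forall v, exists a : R, v - a *: w \in smulT M I) -> free_module (redmod I M).
Proof.
move=> wI wM; pose cl v : redmod I M := quotmod_pi (smulT M I) v.
have clZ a v : piA a *: cl v = cl (a *: v).
  by rewrite -[LHS]/(redmod_scale _ _) redmod_scaleE -[LHS]/(quotmod_scale _ _) quotmod_piZ.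
have clE u v : cl u = cl v <-> u - v \in smulT M I.
  by split=> [/eqP|H]; [|apply/eqP]; rewrite quotmod_piE.
have cl0 : cl 0 = 0 by rewrite -(scale0r w) -clZ rmorph0 scale0r.
apply: (@free_rank1 A (redmod I M) (cl w)) => [a|v].
  rewrite -[a]reprK clZ -cl0 => /clE; rewrite subr0 => /wI/pi_eq0.
  by [].
have [a va] := wM (quotmod_repr v); exists (piA a).
rewrite clZ -[v](@quotmod_reprK _ _ (smulT M I)); exact/clE.
Qed.

(** R/I is Artinian local of finite injective dimension over itself, so [injdim_le_baer] applies
    over R/I with J empty. The conclusion is pulled back to relations on R, the form used by
    [selfinjective_free]. *)
Lemma gorenstein_baer (zs : seq R) : local_gen zs ->
  (forall a, a \in I -> ideal_of zs a) ->
  (forall z, z \in zs -> exists n, z ^+ n \in I) ->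
  finite_injdim (A^o : lmodType A) ->
  forall G : subm (R^o * R^o)%type, (forall a c : R, G (a, c) -> a \in I -> c \in I) ->
  exists c0 : R, forall a c : R, G (a, c) -> c - a * c0 \in I.
Proof.
move=> [zs1 loc] Im nilI /injdim_le_exists[n nA] G GI.
pose zsA : seq A := map piA zs.
have piK (a : A) : exists b : R, a = piA b by exists (repr a); rewrite reprK.
have up (a : R) : ideal_of zs a -> ideal_of zsA (piA a).
  have N0 : (fun b : R => ideal_of zsA (piA b) : Prop) 0 by rewrite /= rmorph0; exact: subm0.
  have NP (c u v : R) : ideal_of zsA (piA u) -> ideal_of zsA (piA v) ->
    ideal_of zsA (piA (c * u + v)).
    by rewrite rmorphD rmorphM; apply: (@submP A A^o).
  apply: (smod_min (N := @Subm R R^o _ N0 NP)) => z v zzs /=.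
  rewrite [z *: v]mulrC; change (ideal_of zsA (piA (v * z))); rewrite rmorphM.
  by apply/(@submZ A A^o)/ideal_of_mem/map_f.
have artA : artin [::] zsA.
  split=> //.
  - split=> [|a].
      (* [N] is the image of ([zs]). If it contained 1, then 1 would be congruent modulo I to an
         element of ([zs]), which contains I. *)
      pose N (b : A) : Prop := exists2 a, b = piA a & ideal_of zs a.
      have N0 : N 0 by exists 0; [rewrite rmorph0|exact: subm0].
      have NP c u v : N u -> N v -> N (c * u + v).
        move=> [a -> za] [b -> zb]; have [e ->] := piK c; exists (e * a + b).
          by rewrite rmorphD rmorphM.
        exact: (@submP R R^o).
      move=> /(smod_min (N := @Subm A A^o _ N0 NP)) [|a a1 za].
        move=> _ v /mapP[z zzs ->]; have [b ->] := piK v; exists (b * z).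
          by rewrite rmorphM mulrC.
        by apply/(@submZ R R^o)/ideal_of_mem.
      apply: zs1; rewrite -(subrK a 1); apply: submD => //; apply/Im/pi_eq0.
      transitivity (piA 1 - piA a); first exact: rmorphB.
      by apply/eqP; rewrite (rmorph1 piA) subr_eq0; apply/eqP.
    have [b ->] := piK a; have [/up|[b' b'b]] := loc b; first by left.
    by right; exists (piA b'); rewrite -rmorphM b'b rmorph1.
  - move=> _ /mapP[z /nilI[k zk] ->]; exists k.
    by rewrite -rmorphXn; exact/pi_eq0.
have [_ baerA] := injdim_le_baer artA nA.
pose GA (z : A^o * A^o) := exists a c, [/\ G (a, c), z.1 = piA a & z.2 = piA c].
have GA0 : GA 0 by exists 0, 0; split; rewrite ?(rmorph0 piA) //; exact: (subm0 G).
have GAP c u v : GA u -> GA v -> GA (c *: u + v).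
  have [r ->] := piK c.
  move=> [a [b [Gab u1 u2]]] [a' [b' [Gab' v1 v2]]].
  exists (r * a + a'), (r * b + b'); split; first exact: (submP r Gab Gab').
    by rewrite (rmorphD piA) (rmorphM piA); congr (_ * _ + _).
  by rewrite (rmorphD piA) (rmorphM piA); congr (_ * _ + _).
have [//|e [a [c [Gac /= /esym/pi_eq0 aI ->]]]|e0 e0E] := baerA (Subm GA0 GAP).
  by apply/pi_eq0; apply: GI Gac aI.
have [c0 c0E] := piK e0; exists c0 => a c Gac; apply/pi_eq0.
have caE : piA c = piA a *: e0 by apply: e0E; exists a, c.
apply/eqP; rewrite (rmorphB piA) (rmorphM piA) subr_eq0; apply/eqP.
by rewrite c0E in caE.
Qed.
End Quotients.

(** * Faithfulness and freeness of M/QM from its socle *)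

Section SocleLifting.
Variables (R : comNzRingType) (zs xs : seq R) (M : lmodType R) (w0 : M).
Hypotheses (artR : artin xs zs).
Local Notation Q := (ideal_of xs).
Hypotheses (w0Q : ~ smod M xs w0) (mw0 : forall a, ideal_of zs a -> smod M xs (a *: w0)).
Hypothesis w0lift : forall s : R, ~ Q s -> (forall a : R, ideal_of zs a -> Q (a * s)) ->
  exists w, smod M xs (s *: w - w0).

Lemma nilpQ (V : lmodType R) (N : subm V) : (forall v, smod V xs v -> N v) -> nilp N zs.
Proof.
move=> NQ; apply: (artin_nilp artR) => a v axs; apply/NQ; exact: smod_mul.
Qed.

Lemma socle_ideal (a : R) : ~ Q a ->
  exists b : R, ~ Q (b * a) /\ forall c : R, ideal_of zs c -> Q (c * (b * a)).
Proof. exact: (@socle_mod R R^o Q zs a (@nilpQ R^o Q _)). Qed.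

(** If a is not in Q, some multiple of a is a nonzero socle element of R/Q, and it sends some w to
    [w0], which is nonzero modulo QM. *)
Lemma faithful_quotient (a : R) : (forall v : M, smod M xs (a *: v)) -> Q a.
Proof.
move=> aM; apply: contrapT => /socle_ideal[b [nQba mba]].
have [w bw] := w0lift nQba mba; apply: w0Q.
rewrite -[w0](subKr ((b * a) *: w)); apply: submB => //.
by rewrite -scalerA; apply: submZ.
Qed.

Lemma selfinjective_free :
  (forall v, (forall a, ideal_of zs a -> smod M xs (a *: v)) ->
     exists r, smod M xs (v - r *: w0)) ->
  ~ Q 1 ->
  (forall G : subm (R^o * R^o)%type, (forall a c : R, G (a, c) -> Q a -> Q c) ->
    exists c0 : R, forall a c : R, G (a, c) -> Q (c - a * c0)) ->
  exists w, (forall a, smod M xs (a *: w) -> Q a) /\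
    forall v, exists a, smod M xs (v - a *: w).
Proof.
move=> w0gen Q1 selfinj.
have [s0 [sQ ms]] := socle_ideal Q1; set s := s0 * 1 in sQ ms.
have [w sw] := w0lift sQ ms.
have winj (a : R) : smod M xs (a *: w) -> Q a.
  move=> aw; apply: contrapT => /socle_ideal[b [nQba mba]].
  (* The relation sends the socle element b a to s. Self-injectivity gives s = b a c0 modulo Q, so a
     w = 0 would force [w0] = s w = 0. *)
  pose G (z : R^o * R^o) := exists r : R, Q (z.1 - r * (b * a)) /\ Q (z.2 - r * s).
  have G0 : G 0 by exists 0; split; rewrite mul0r subr0; exact: subm0.
  have GP c u u' : G u -> G u' -> G (c *: u + u').
    move=> [r [H1 H2]] [r' [H1' H2']]; exists (c * r + r').
    split; rewrite mulrDl opprD -mulrA addrACA -[c * (r * _)]/(c *: (_ : R^o)).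
      by rewrite -scalerBr; apply: submP.
    by rewrite -scalerBr; apply: submP.
  have [c e [r [/= H1 H2]] Qc|c0 c0E] := selfinj (Subm G0 GP).
    have mr : ideal_of zs r.
      apply: (artin_unit artR nQba); rewrite -[r * _](subKr c).
      exact: (submB Qc H1).
    by rewrite -[e](subrK (r * s)); apply: submD => //; apply: ms.
  have Gs : G (b * a, s).
    by exists 1; rewrite !mul1r !subrr; split; exact: subm0.
  have Qs := c0E _ _ Gs; apply: w0Q; rewrite -[w0](subKr (s *: w)); apply: submB => //.
  rewrite -[s](subrK (b * a * c0)) scalerDl; apply: submD; first exact: smod_scale.
  by rewrite mulrAC -scalerA; apply: submZ.
exists w; split=> // v; apply: contrapT.
pose T v := exists a : R, smod M xs (v - a *: w).
have T0 : T 0 by exists 0; rewrite scale0r subr0; exact: subm0.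
have TP c u u' : T u -> T u' -> T (c *: u + u').
  move=> [r Hr] [r' Hr']; exists (c * r + r').
  by rewrite scalerDl opprD -scalerA addrACA -scalerBr; apply: submP.
have nilT : nilp (Subm T0 TP) zs.
  by apply: nilpQ => u Qu; exists 0; rewrite scale0r subr0.
move=> /(@socle_mod R M (Subm T0 TP) zs v nilT)[b [nT mT]].
apply: nT; change (T (b *: v)).
have {}mT : forall a, ideal_of zs a -> T (a *: (b *: v)) := mT.
move: (b *: v) mT => {T0 TP nilT b}v mT.
(* Now v represents a socle element modulo Rw. Extending the relation a v = c w gives [c0] such that
   v - c0 w lies in the socle of M/QM, hence is r w0 = r s w there. *)
pose G (z : R^o * R^o) := smod M xs (z.1 *: v - z.2 *: w).
have G0 : G 0 by rewrite /G !scale0r subr0; exact: subm0.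
have GP c u u' : G u -> G u' -> G (c *: u + u').
  move=> Gu Gu'; have := submP c Gu Gu'; congr (in_subm _ _).
  by rewrite scalerBr !scalerA addrACA -opprD -!scalerDl.
have [c e /= Gce Qc|c0 c0E] := selfinj (Subm G0 GP).
  apply: winj; rewrite -[e *: w](subKr (c *: v)); apply: submB => //.
  exact: smod_scale.
have [a ma|r Hr] := w0gen (v - c0 *: w).
  have [c avc] := mT a ma; have Qc := c0E a c avc.
  rewrite scalerBr -[a *: v](subrK (c *: w)) -addrA; apply: submD => //.
  by rewrite scalerA -scalerBl; apply: smod_scale.
exists (c0 + r * s); rewrite scalerDl opprD addrA -scalerA.
rewrite -[r *: (s *: w)](subrK (r *: w0)) opprD [- _ - _]addrC addrA.
by apply: submB => //; rewrite -scalerBr; apply: submZ.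
Qed.
End SocleLifting.

(** * Uniqueness of dimension and depth, and final bookkeeping *)

Lemma krull_dim_unique (R : comNzRingType) p q :
  krull_dim R p -> krull_dim R q -> p = q.
Proof. by move=> [pc pm] [qc qm]; apply/eqP; rewrite eqn_leq qm ?pm. Qed.

Lemma depth_unique (R : comNzRingType) (m : idealr R) (M : lmodType R) p q :
  depth m M p -> depth m M q -> p = q.
Proof.
move=> [[s [sreg <-]] pm] [[t [treg <-]] qm].
by apply/eqP; rewrite eqn_leq pm // qm.
Qed.

Lemma depth_rreg (R : comNzRingType) (m : idealr R) (M : lmodType R) n :
  depth m M n -> exists ws, [/\ {subset ws <= m}, rreg M ws & size ws = n].
Proof.
move=> [[s [[sm sreg] <-]] _]; exists (rev s); split; last exact: size_rev.
  by move=> y; rewrite mem_rev; apply: sm.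
exact: regular_seq_rreg.
Qed.

Lemma eq_smulT (R : comNzRingType) (M : lmodType R) (I J : {pred R}) :
  I =i J -> smulT M I =i smulT M J.
Proof.
move=> IJ v; apply/asboolP/asboolP => -[n [a [w [aI wN vE]]]];
  by exists n, a, w; split=> // i; rewrite ?IJ // -IJ.
Qed.

Lemma smulT_ring (R : comNzRingType) (I : idealr R) (a : R) :
  a \in smulT R^o I <-> a \in I.
Proof.
split=> [/asboolP[n [c [w [cI _ ->]]]]|aI].
  by apply: rpred_sum => i _; rewrite [_ *: _]mulrC; apply: idealMr.
apply/asboolP; exists 1%N, (fun=> a), (fun=> 1); split=> //.
by rewrite big_ord1 [_ *: _]mulr1.
Qed.

Theorem corollary3p6 (R : comNzRingType) (m : idealr R) (d : nat)
    (omega : lmodType R) (I : idealr R) (x : d.-tuple R)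
    (hR : CM_local_ring m) (hd : krull_dim R d)
    (homega : canonical_module m omega)
    (hI : m_primary m I)
    (hx : system_of_parameters m x)
    (hQ : reduction (ideal_gen x) I)
    (hG : gorenstein_local {ideal_quot I}) :
  [<-> (* (i) *) parameter_ideal m I;
       (* (ii) *) ulrich m I (ideal_gen x) R^o;
       (* (iii) *) ulrich m I (ideal_gen x) omega].
Proof.
have [nR locR [n [nd depR]]] := hR.
have {n nd depR} depR : depth m R^o d by rewrite (krull_dim_unique hd nd).
have [omegaCM [t [P [dept isoP]]] injo] := homega.
have [fgo [n [nd depo]]] := omegaCM.
have {n nd} depo : depth m omega d by rewrite (krull_dim_unique hd nd).
have {dept} td : t = d := depth_unique dept depo.
have [zs [loc mzs]] := local_gen_exists nR locR.
have noethR := noeth_ring nR.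
have noetho := noeth_fin_gen noethR fgo.
have [wsR [wsRm wsRreg wsRd]] := depth_rreg depR.
have [wso [wsom wsoreg wsod]] := depth_rreg depo.
have [[hd' [_ mx]] [_ mI]] := (hx, hI).
pose xs := rev x.
have Qx (a : R) : ideal_of xs a <-> a \in ideal_gen x.
  by rewrite ideal_ofE; apply: smod_rev.
have xsz : size xs = d by rewrite size_rev size_tuple.
have xsm y : y \in xs -> ideal_of zs y.
  by move=> yx; apply/mzs/mx; exists 1%N; apply/Qx; rewrite expr1; apply: ideal_of_mem.
have rad y : y \in m -> exists k, ideal_of xs (y ^+ k).
  by move=> /mx[k yk]; exists k; apply/Qx.
have regR : rreg R^o xs.
  by apply: (sop_rreg noethR loc xsm _ wsRreg); [move=> y /wsRm/rad|rewrite wsRd xsz].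
have rego : rreg omega xs.
  by apply: (sop_rreg noetho loc xsm _ wsoreg); [move=> y /wsom/rad|rewrite wsod xsz].
have artx : artin xs zs.
  by split=> // z zzs; apply/rad/mzs/ideal_of_mem.
have Q1 : ~ ideal_of xs 1.
  move=> Q1; case: loc => zs1 _; apply: zs1.
  apply: (smod_min (N := ideal_of zs)) Q1 => y v /xsm.
  by rewrite [_ *: _]mulrC; apply: (@submZ R R^o).
have Im a : a \in I -> ideal_of zs a.
  by move=> aI; apply/mzs/mI; exists 1%N; rewrite expr1.
(* Type 1 says that Ext^d(k, omega) is cyclic and nonzero; descending along [xs] turns this into a
   one-dimensional socle of omega/Q omega. *)
have [w0 [w0Q mw0 w0gen]] : exists w0, socle_gen m (smod omega xs) w0.
  apply: (ext_cyclic_socle (P := P)); rewrite -[xs]cats0.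
  apply: ext_cyclic_rreg => [|y yxs v|]; [by rewrite cats0| |by rewrite xsz -td; apply: Ext_cyclic].
  have [a ->] := res_surj v; rewrite res_scale; apply/res0; rewrite mulrC.
  by apply: idealMr; apply/mzs/xsm.
have w0lift (s : R) : ~ ideal_of xs s ->
    (forall a : R, ideal_of zs a -> ideal_of xs (a * s)) ->
    exists w, smod omega xs (s *: w - w0).
  move=> sQ ms; have [n0 n0o] := injdim_le_exists injo.
  have [n1 [W [p [surjp pE n1W]]]] := injdim_le_rreg regR rego n0o.
  (* Sending s to [w0] is well defined: if r s lies in Q, then r is in m and kills [w0]. *)
  have [||e [_ se]] := baer_extend (K := ideal_of xs) (b := s) (w := p w0)
    (injdim_le_baer artx n1W).
  - exact: ideal_of_mem.
  - move=> r rs; rewrite -linearZ; apply/pE/mw0/mzs.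
    exact: artin_unit artx sQ rs.
  have [w we] := surjp e; exists w; apply/pE.
  by rewrite linearB linearZ /= we se subrr.
have smI (M : lmodType R) v : v \in smulT M (ideal_gen x) <-> smod M xs v.
  by rewrite smodE; apply: iff_sym; apply: smod_rev.
have QI a : a \in ideal_gen x -> a \in I by case: hQ => + _; apply.
have parI : (forall a, a \in I -> a \in ideal_gen x) -> I =i ideal_gen x.
  by move=> IQ a; apply/idP/idP; [exact: IQ|exact: QI].
tfae.
- move=> [y [[yd _] Iy]].
  have {}yd : size y = d := krull_dim_unique yd hd.
  have IQ : I =i ideal_gen x.
    apply/parI/(reduction_eq noethR loc Im wsRreg _ hQ Iy); last by rewrite yd wsRd.
    by move=> w /wsRm/mI.
  split.
  + split; last by exists d.
    exists [:: 1] => a; apply/asboolP; exists (fun=> a).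
    by rewrite big_ord1 /= [_ *: _]mulr1.
  + exact: eq_smulT.
  + apply: (@free_redmod R I R^o 1) => [a|v].
      by rewrite [_ *: _]mulr1 => /smulT_ring.
    by exists v; rewrite [_ *: _]mulr1 subrr; apply/smulT_ring/rpred0.
- move=> [_ IQ _].
  have {}IQ : I =i ideal_gen x.
    apply: parI => a /smulT_ring; rewrite IQ => /smI.
    by move/Qx.
  have [_ _ injA] := hG.
  have IxQ (a : R) : a \in I <-> ideal_of xs a by rewrite Qx IQ.
  have [v mv|G GQ|w [winj wsurj]] := selfinjective_free artx w0Q w0lift _ Q1.
  + by apply: w0gen => a /mzs; apply: mv.
  + have [|a c /GQ + /IxQ Qa|c0 c0E] := gorenstein_baer loc Im _ injA (G := G).
    * by move=> z zzs; apply/mI/mzs/ideal_of_mem.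
    * by move=> /(_ Qa)/IxQ.
    by exists c0 => a c /c0E/IxQ.
  have smIo v : v \in smulT omega I <-> smod omega xs v.
    by rewrite -smI (eq_smulT IQ).
  split; [exact: omegaCM|exact: eq_smulT|].
  apply: (free_redmod (w := w)) => [a /smIo/winj/IxQ//|v].
  by have [a va] := wsurj v; exists a; apply/smIo.
(* I annihilates omega/Q omega, which is faithful over R/Q. *)
- move=> [_ IQ _]; exists x; split=> //; apply: parI => a aI.
  apply/Qx; apply: (faithful_quotient artx w0Q w0lift) => v.
  apply/smI; rewrite -IQ; apply/asboolP; exists 1%N, (fun=> a), (fun=> v).
  by split=> //; rewrite big_ord1.
Qed.
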